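(* Let $g$ be a partial permutation of $[n]=\{1,\dots,n\}$ with path type $\mu$ and cycle type $\nu$, and let $\chi:\mathfrak{S}_n\to\mathbb{C}$ be a class function, extended linearly to $\chi:\mathbb{C}[\mathfrak{S}_n]\to\mathbb{C}$. Then $$\chi(a_g)=(-1)^{|\mu|-\ell(\mu)}\, m(\mu)!\cdot\langle \mathrm{ch}(\chi),\, f_\mu\cdot p_\nu\rangle .$$
   Context: $\mathfrak{S}_n$ is the symmetric group on $[n]$. A partial permutation of $[n]$ is a bijection $g:I\to J$ between two subsets $I,J\subseteq[n]$ (the ambient set $[n]$ is part of the data). The group algebra element $a_g\in\mathbb{C}[\mathfrak{S}_n]$ is $$a_g:=\sum_{w\in\mathfrak{S}_n,\ w(i)=g(i)\text{ for all }i\in I} w .$$ Associate to $g$ the directed graph on vertex set $[n]$ with an edge $i\to g(i)$ for each $i\in I$. Each connected component is a directed path (possibly an isolated vertex with no edges) or a directed cycle (a loop $i\to i$ is a cycle of size 1). The path type $\mu$ of $g$ is the partition listing the sizes (numbers of vertices) of the path components in weakly decreasing order; the cycle type $\nu$ is the partition listing the sizes of the cycle components. So $|\mu|+|\nu|=n$. For a partition $\mu$, $|\mu|$ is the sum of its parts, $\ell(\mu)$ is its number of parts, and $m(\mu)!:=\prod_{i\ge1}m_i(\mu)!$, where $m_i(\mu)$ is the multiplicity of $i$ as a part of $\mu$. $\Lambda$ is the ring of symmetric functions over $\mathbb{C}$ with monomial basis $m_\lambda$, elementary basis $e_\lambda$, complete homogeneous basis $h_\lambda$, power sum basis $p_\lambda$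 and Schur basis $s_\lambda$. $\langle-,-\rangle$ is the Hall inner product (bilinear form making the $s_\lambda$ orthonormal), $\omega$ is the algebra involution with $\omega(e_\lambda)=h_\lambda$, and the forgotten basis is $f_\lambda:=\omega(m_\lambda)$. The Frobenius characteristic of a class function $\chi:\mathfrak{S}_n\to\mathbb{C}$ is $\mathrm{ch}(\chi)=\frac{1}{n!}\sum_{w\in\mathfrak{S}_n}\chi(w)\,p_{\mathrm{cyc}(w)}$, where $\mathrm{cyc}(w)\vdash n$ is the cycle type of $w$. *)

(* Defs.v *)
From HB Require Import structures.
From mathcomp Require Import all_boot all_order all_fingroup all_algebra.
From mathcomp Require Import sesquilinear boolp.
From mathcomp.multinomials Require Import mpoly.

Set Implicit Arguments.
Unset Strict Implicit.
Unset Printing Implicit Defensive.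

Import GRing.Theory.
Local Open Scope ring_scope.

Definition is_partition (la : seq nat) : bool := sorted geq la && (0%N \notin la).

Definition mult_fact (la : seq nat) : nat :=
  (\prod_(i <- undup la) (count_mem i la)`!)%N.

(* [pp_map g i = Some j] means that i belongs to the domain I of g and
   g(i) = j; the codomain J is the image of g. *)
Record partial_perm (n : nat) := PartialPerm {
  pp_map :> {ffun 'I_n -> option 'I_n};
  pp_injP : forall i j k : 'I_n,
    pp_map i = Some k -> pp_map j = Some k -> i = j }.

Section PartialPerm.
Variables (n : nat) (g : partial_perm n).

Definition edge : rel 'I_n := fun i j => g i == Some j.

Definition components : {set {set 'I_n}} :=
  equivalence_partition (connect (fun i j => edge i j || edge j i)) [set: 'I_n].

(* The edges inside C are exactly t_1 -> t_2 -> ... -> t_k, where t lists C. *)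
Definition is_dipath (C : {set 'I_n}) : bool :=
  [exists t : #|C|.-tuple 'I_n,
    [&& uniq t, C == [set i in t] &
      [forall i in C, forall j in C, edge i j == (index j t == (index i t).+1)]]].

(* The edges inside C are exactly t_1 -> t_2 -> ... -> t_k -> t_1. *)
Definition is_dicycle (C : {set 'I_n}) : bool :=
  [exists t : #|C|.-tuple 'I_n,
    [&& uniq t, C == [set i in t] &
      [forall i in C, forall j in C, edge i j == (j == next t i)]]].

Definition path_type : seq nat :=
  sort geq [seq #|C| | C : {set 'I_n} <- enum components & is_dipath C].

Definition cycle_type : seq nat :=
  sort geq [seq #|C| | C : {set 'I_n} <- enum components & is_dicycle C].

End PartialPerm.

Definition perm_type (n : nat) (w : 'S_n) : seq nat :=
  sort geq [seq #|C| | C : {set 'I_n} <- enum (porbits w)].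

Section GroupAlgebra.
Variables (K : comNzRingType) (n : nat).

(* An element of K['S_n] is the family of its coefficients. *)
Definition group_alg := {ffun 'S_n -> K}.

Definition perm_elt (w : 'S_n) : group_alg := [ffun u => (u == w)%:R].

Definition a_elt (g : partial_perm n) : group_alg :=
  \sum_(w : 'S_n | [forall i, forall j, (g i == Some j) ==> (w i == j)])
     perm_elt w.

Definition class_function (chi : 'S_n -> K) : Prop :=
  forall u v : 'S_n, chi (u ^ v)%g = chi u.

Definition linear_ext (chi : 'S_n -> K) (x : group_alg) : K :=
  \sum_(w : 'S_n) x w * chi w.

End GroupAlgebra.

(* Families (f_N)_N with f_N a polynomial in N variables, with the pointwise
   algebra structure; symmetric functions are the symmetric families of
   bounded degree which are compatible with setting the last variable to 0. *)
Definition mpoly_family (K : comNzRingType) := forall N : nat, {mpoly K[N]}.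

Section Family.
Variable K : comNzRingType.
Local Notation family := (mpoly_family K).

HB.instance Definition _ := gen_eqMixin family.
HB.instance Definition _ := gen_choiceMixin family.

Lemma familyP (f g : family) : (forall N, f N = g N) -> f = g.
Proof. exact: functional_extensionality_dep. Qed.

Definition family0 : family := fun=> 0.
Definition family1 : family := fun=> 1.
Definition family_opp (f : family) : family := fun N => - f N.
Definition family_add (f g : family) : family := fun N => f N + g N.
Definition family_mul (f g : family) : family := fun N => f N * g N.
Definition family_scale (a : K) (f : family) : family := fun N => a *: f N.

Fact family_addA : associative family_add.
Proof. by move=> f g h; apply: familyP => N; apply: addrA. Qed.
Fact family_addC : commutative family_add.
Proof. by move=> f g; apply: familyP => N; apply: addrC. Qed.
Fact family_add0 : left_id family0 family_add.
Proof. by move=> f; apply: familyP => N; apply: add0r. Qed.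
Fact family_addN : left_inverse family0 family_opp family_add.
Proof. by move=> f; apply: familyP => N; apply: addNr. Qed.
HB.instance Definition _ := GRing.isZmodule.Build family
  family_addA family_addC family_add0 family_addN.

Fact family_mulA : associative family_mul.
Proof. by move=> f g h; apply: familyP => N; apply: mulrA. Qed.
Fact family_mulC : commutative family_mul.
Proof. by move=> f g; apply: familyP => N; apply: mulrC. Qed.
Fact family_mul1 : left_id family1 family_mul.
Proof. by move=> f; apply: familyP => N; apply: mul1r. Qed.
Fact family_mulDl : left_distributive family_mul +%R.
Proof. by move=> f g h; apply: familyP => N; apply: mulrDl. Qed.
Fact family_oner_neq0 : family1 != 0.
Proof.
apply/eqP => /(congr1 (fun f : family => f 0%N)) /eqP.
by rewrite (oner_eq0 {mpoly K[0]}).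
Qed.
HB.instance Definition _ := GRing.Zmodule_isComNzRing.Build family
  family_mulA family_mulC family_mul1 family_mulDl family_oner_neq0.

Fact family_scaleA a b f : family_scale a (family_scale b f) = family_scale (a * b) f.
Proof. by apply: familyP => N; apply: scalerA. Qed.
Fact family_scale1 : left_id 1 family_scale.
Proof. by move=> f; apply: familyP => N; apply: scale1r. Qed.
Fact family_scaleDr : right_distributive family_scale +%R.
Proof. by move=> a f g; apply: familyP => N; apply: scalerDr. Qed.
Fact family_scaleDl f : {morph family_scale^~ f : a b / a + b}.
Proof. by move=> a b; apply: familyP => N; apply: scalerDl. Qed.
HB.instance Definition _ := GRing.Zmodule_isLmodule.Build K family
  family_scaleA family_scale1 family_scaleDr family_scaleDl.

Fact family_scaleAl a (f g : family) : a *: (f * g) = a *: f * g.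
Proof. by apply: familyP => N; apply: scalerAl. Qed.
HB.instance Definition _ := GRing.Lmodule_isLalgebra.Build K family family_scaleAl.
HB.instance Definition _ := GRing.Lalgebra_isComAlgebra.Build K family.

Definition drop_last N (p : {mpoly K[N.+1]}) : {mpoly K[N]} :=
  p \mPo [tuple if unlift ord_max i is Some j then 'X_j else 0 | i < N.+1].

Definition symfun_prop (f : family) : Prop :=
  [/\ forall N, f N \is symmetric,
      forall N, drop_last (f N.+1) = f N
    & exists d, forall N, (msize (f N) <= d)%N].

Definition symfun_pred : {pred family} := fun f => `[< symfun_prop f >].

Fact symfun_subalg_closed : subalg_closed symfun_pred.
Proof.
split=> [|a f g|f g].
- apply/asboolP; split=> [N|N|]; first by apply/issymP => s; exact: msym1.
    exact: comp_mpoly1.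
  by exists 1%N => N; rewrite msize1.
- move=> /asboolP[fS fR [df fd]] /asboolP[gS gR [dg gd]]; apply/asboolP; split.
  + move=> N; apply/issymP => s; rewrite msymD msymZ.
    by rewrite (issymP _ (fS N)) (issymP _ (gS N)).
  + move=> N; transitivity (a *: f N + g N) => //.
    by rewrite -fR -gR /drop_last -comp_mpolyZ -comp_mpolyD.
  + exists (maxn df dg) => N; apply: (leq_trans (msizeD_le (a *: f N) (g N))).
    rewrite geq_max (leq_trans (msizeZ_le _ _)) ?leq_max ?fd //.
    by rewrite gd orbT.
- move=> /asboolP[fS fR [df fd]] /asboolP[gS gR [dg gd]]; apply/asboolP; split.
  + move=> N; apply/issymP => s; rewrite msymM.
    by rewrite (issymP _ (fS N)) (issymP _ (gS N)).
  + move=> N; transitivity (f N * g N) => //.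
    by rewrite -fR -gR /drop_last -rmorphM.
  + exists (df + dg).+1 => N; apply: (leq_trans (msizeM_le (f N) (g N))).
    by rewrite ltnS leq_add.
Qed.
HB.instance Definition _ :=
  GRing.isSubalgClosed.Build K family symfun_pred symfun_subalg_closed.

End Family.

Record symfun (K : comNzRingType) := SymFun {
  in_vars : mpoly_family K;
  _ : in_vars \in @symfun_pred K }.

Section SymFun.
Variable K : comNzRingType.

HB.instance Definition _ := [isSub for @in_vars K].
HB.instance Definition _ := [Choice of symfun K by <:].
HB.instance Definition _ := [SubChoice_isSubComNzRing of symfun K by <:].
HB.instance Definition _ := [SubZmodule_isSubLmodule of symfun K by <:].
HB.instance Definition _ := [SubNzRing_SubLmodule_isSubLalgebra of symfun K by <:].
HB.instance Definition _ := GRing.Lalgebra_isComAlgebra.Build K (symfun K).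

Lemma mcoeff_drop_last N (p : {mpoly K[N.+1]}) m :
  (drop_last p)@_m = p@_(mnmwiden m).
Proof.
rewrite /drop_last [in LHS](mpolyE p) [in RHS](mpolyE p).
rewrite (raddf_sum (comp_mpoly _)) (raddf_sum (mcoeff m)) (raddf_sum (mcoeff _)).
apply: eq_bigr => k _ /=.
rewrite comp_mpolyZ !mcoeffZ; congr (_ * _); rewrite comp_mpolyX mcoeffX.
rewrite big_ord_recr /= tnth_mktuple unlift_none.
under eq_bigr => i _.
  rewrite tnth_mktuple (_ : widen_ord _ i = lift ord_max i); last first.
    by apply: val_inj; rewrite /= /bump leqNgt ltn_ord.
  rewrite liftK; over.
set q := [multinom k (lift ord_max i) | i < N].
have -> : \prod_(i < N) ('X_i : {mpoly K[N]}) ^+ k (lift ord_max i) = 'X_[q].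
  by rewrite [in RHS]mpolyXE_id; apply: eq_bigr => i _; rewrite mnmE.
have widenE i : mnmwiden m (lift ord_max i) = m i.
  have -> : lift ord_max i = widen_ord (leqnSn N) i.
    by apply: val_inj; rewrite /= /bump leqNgt ltn_ord.
  exact: mnmwiden_widen.
have [k0|k0] := eqVneq (k ord_max) 0%N.
  rewrite k0 expr0 mulr1 mcoeffX; congr (_%:R); congr nat_of_bool.
  apply/eqP/eqP => [qm|km].
    apply/mnmP => i; case: (unliftP ord_max i) => [j|] ->.
      by rewrite widenE -qm mnmE.
    by rewrite k0 mnmwiden_ordmax.
  by apply/mnmP => j; rewrite mnmE km widenE.
rewrite expr0n (negbTE k0) mulr0 mcoeff0; case: eqP => // km.
by rewrite km mnmwiden_ordmax eqxx in k0.
Qed.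

(* The partition underlying an exponent vector. *)
Definition mnm_part N (m : 'X_{1..N}) : seq nat :=
  sort geq [seq i <- m | i != 0%N].

(* sum of phi(la) m_la over all partitions la with |la| <= d *)
Definition mono_sum_family (d : nat) (phi : seq nat -> K) : mpoly_family K :=
  fun N => \sum_(m : 'X_{1..N < d.+1}) phi (mnm_part m) *: 'X_[m].

Lemma mcoeff_mono_sum d phi N (m : 'X_{1..N}) :
  (mono_sum_family d phi N)@_m = if (mdeg m <= d)%N then phi (mnm_part m) else 0.
Proof.
case: leqP => md; first exact: (mcoeff_mpoly (fun m => phi (mnm_part m))).
rewrite raddf_sum /= big1 // => k _; rewrite mcoeffZ mcoeffX.
case: eqP => [km|_]; last by rewrite mulr0.
by have := bmdeg k; rewrite km ltnS leqNgt md.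
Qed.

Fact mono_sum_subproof d phi : mono_sum_family d phi \in @symfun_pred K.
Proof.
have geq_tot : total geq by move=> x y; apply: leq_total.
have geq_tr : transitive geq by move=> x y z /= ? /leq_trans; apply.
have geq_asym : antisymmetric geq by move=> x y; rewrite andbC => /anti_leq.
have sortE := perm_sortP geq_tot geq_tr geq_asym.
apply/asboolP; split=> [N|N|].
- apply/issymP => s; apply/mpolyP => m; rewrite mcoeff_sym !mcoeff_mono_sum mdeg_mperm.
  case: ifP => // _; congr phi; apply/sortE/perm_filter.
  apply/tuple_permP; exists s.
  by [].
- apply/mpolyP => m; rewrite mcoeff_drop_last !mcoeff_mono_sum.
  have -> : mdeg (mnmwiden m) = mdeg m.
    by rewrite !mdegE big_ord_recr /= mnmwiden_ordmax addn0;
       apply: eq_bigr => i _; rewrite mnmwiden_widen.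
  case: ifP => // _; congr phi; congr sort.
  by rewrite -[X in filter _ X]/(rcons m 0%N) filter_rcons.
- exists d.+1 => N; rewrite msizeE; apply/bigmax_leqP_seq => m + _.
  rewrite mcoeff_msupp mcoeff_mono_sum ltnS.
  by case: leqP => // _; rewrite eqxx.
Qed.

Definition mono_sum d phi : symfun K := SymFun (mono_sum_subproof d phi).

Definition sym_m (la : seq nat) : symfun K :=
  mono_sum (sumn la) (fun mu => (mu == la)%:R).

(* sym_p1 0 is 0, a junk value: parts of partitions are positive. *)
Definition sym_e1 (k : nat) : symfun K := sym_m (nseq k 1%N).
Definition sym_h1 (k : nat) : symfun K := mono_sum k (fun mu => (sumn mu == k)%:R).
Definition sym_p1 (k : nat) : symfun K := sym_m [:: k].

Definition sym_e (la : seq nat) : symfun K := \prod_(k <- la) sym_e1 k.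
Definition sym_h (la : seq nat) : symfun K := \prod_(k <- la) sym_h1 k.
Definition sym_p (la : seq nat) : symfun K := \prod_(k <- la) sym_p1 k.

(* s is the Schur function s_la, defined by ratios of alternants: in
   N >= l(la) variables,
     s(x_1, ..., x_N) = det (x_j ^ (la_i + N - i)) / det (x_j ^ (N - i)).
   Since compatible families are determined by their members for large N,
   there is exactly one such s. *)
Definition alternant N (alpha : nat -> nat) : {mpoly K[N]} :=
  \det (\matrix_(i < N, j < N) 'X_j ^+ alpha i).

Definition is_schur (la : seq nat) (s : symfun K) : Prop :=
  forall N, (size la <= N)%N ->
    in_vars s N * alternant N (fun i => N.-1 - i)%N
    = alternant N (fun i => nth 0%N la i + (N.-1 - i))%N.

Definition is_hall (hall : {biscalar symfun K}) : Prop :=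
  forall (la mu : seq nat) (s t : symfun K),
    is_partition la -> is_partition mu -> is_schur la s -> is_schur mu t ->
    hall s t = (la == mu)%:R.

Definition is_omega (omega : {lrmorphism symfun K -> symfun K}) : Prop :=
  involutive omega /\ forall la, is_partition la -> omega (sym_e la) = sym_h la.

Definition forgotten (omega : {lrmorphism symfun K -> symfun K}) (la : seq nat) :
  symfun K := omega (sym_m la).

End SymFun.

Definition frob_ch (K : fieldType) (n : nat) (chi : 'S_n -> K) : symfun K :=
  (n`!%:R)^-1 *: \sum_(w : 'S_n) chi w *: sym_p K (perm_type w).

(* Main.v *)
(* For every permutation w, pairing ch(chi) with p_cyc(w) gives chi(w), so the theorem
   amounts to the identity of symmetric functions
     sum_(w extending g) p_cyc(w) = (-1)^(|mu| - l(mu)) m(mu)! f_mu p_nu.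
   In the variables x_1, ..., x_N, p_cyc(w) is the sum of the monomials prod_i x_f(i)
   over the colourings f of [n] with f o w = f.  A colouring f is compatible with some
   w extending g iff it is constant on the components of g, and then the compatible
   extensions are the colour-preserving bijections from the ends to the starts of the
   paths: there are prod_c k_c! of them, k_c being the number of paths of colour c.
   The resulting sum W(mu) over the colourings of the paths obeys
     W(a, mu) = p_a W(mu) + sum_i W(mu with a merged into mu_i),
   while the augmented monomials M(mu) = m(mu)! m_mu obey the same recursion with a
   minus sign; as omega p_k = (-1)^(k-1) p_k, this gives W(mu) = (-1)^(|mu|-l(mu)) omega M(mu).

   For the pairing: a_delta f = sum_la c_la a_(la + delta) expands f in Schur functions
   (Jacobi-Trudi provides them), hence N! <f, g> = sum_m [x^m](a_delta f) [x^m](a_delta g)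
   as soon as N bounds the degrees.  For this form the adjoint of multiplication by x_i^k
   lowers an exponent by k, which yields <p_k f, p_la> = k m_k(la) <f, p_(la - k)>.
   So distinct power sums are orthogonal, and <n! h_n, p_la> = n! with
   n! h_n = sum_w p_cyc(w) replaces the count of a conjugacy class. *)
Require Import Defs.
From mathcomp Require Import all_boot all_order all_fingroup all_algebra.
From mathcomp Require Import sesquilinear boolp.
From mathcomp.multinomials Require Import mpoly.

Set Implicit Arguments.
Unset Strict Implicit.
Unset Printing Implicit Defensive.

Import GRing.Theory Num.Theory.
Local Open Scope ring_scope.

Local Notation "m # s" := [multinom m (s i) | i < _]
  (at level 40, left associativity, format "m # s").

Arguments in_vars : simpl never.
Arguments sym_p1 : simpl never.

Lemma geq_total : total geq.
Proof. by move=> x y; apply: leq_total. Qed.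

Lemma geq_trans : transitive geq.
Proof. by move=> x y z /= /[swap]; apply: leq_trans. Qed.

Lemma geq_anti : antisymmetric geq.
Proof. by move=> x y; rewrite andbC => /anti_leq. Qed.

Lemma gtn_trans : transitive gtn.
Proof. by move=> x y z /= /[swap]; apply: ltn_trans. Qed.

Lemma submMnK N (m : 'X_{1..N}) i k : (k <= m i)%N -> (m - U_(i) *+ k + U_(i) *+ k = m)%MM.
Proof.
move=> km; apply: submK; apply/mnm_lepP => j; rewrite mulmnE mnm1E.
by case: eqP => [<-|]; rewrite ?mul1n ?mul0n.
Qed.

Lemma mcoeff_msupp_sum (K : nzRingType) N (P : {mpoly K[N]}) k :
  \sum_(m <- msupp P) P@_m *+ (m == k) = P@_k.
Proof.
rewrite [in RHS](mpolyE P) raddf_sum /=; apply: eq_bigr => m _.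
by rewrite mcoeffZ mcoeffX mulr_natr.
Qed.

(** * Symmetric functions and their specializations *)

Section InVars.
Variable K : comNzRingType.
Implicit Types (f g : symfun K) (N : nat).

Lemma in_varsD N f g : in_vars (f + g) N = in_vars f N + in_vars g N.
Proof. by []. Qed.
Lemma in_varsM N f g : in_vars (f * g) N = in_vars f N * in_vars g N.
Proof. by []. Qed.
Lemma in_varsZ N a f : in_vars (a *: f) N = a *: in_vars f N.
Proof. by []. Qed.
Lemma in_vars1 N : in_vars (1 : symfun K) N = 1. Proof. by []. Qed.
Lemma in_vars0 N : in_vars (0 : symfun K) N = 0. Proof. by []. Qed.
Lemma in_varsN N f : in_vars (- f) N = - in_vars f N. Proof. by []. Qed.

Lemma in_varsMn N f n : in_vars (f *+ n) N = in_vars f N *+ n.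
Proof. by elim: n => // n IH; rewrite !mulrS in_varsD IH. Qed.

Lemma in_vars_sum N I (r : seq I) (P : pred I) (F : I -> symfun K) :
  in_vars (\sum_(i <- r | P i) F i) N = \sum_(i <- r | P i) in_vars (F i) N.
Proof. exact: (big_morph (fun f => in_vars f N) (in_varsD N) (in_vars0 N)). Qed.

Lemma in_vars_prod N I (r : seq I) (P : pred I) (F : I -> symfun K) :
  in_vars (\prod_(i <- r | P i) F i) N = \prod_(i <- r | P i) in_vars (F i) N.
Proof. exact: (big_morph (fun f => in_vars f N) (in_varsM N) (in_vars1 N)). Qed.

Lemma symfunP f g : (forall N, in_vars f N = in_vars g N) -> f = g.
Proof. by move=> fg; apply: val_inj; exact: (@Defs.familyP K (in_vars f) (in_vars g) fg). Qed.

Lemma in_vars_symfun f : symfun_prop (in_vars f).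
Proof. by apply/asboolP; case: f. Qed.

Lemma in_vars_sym N f s : msym s (in_vars f N) = in_vars f N.
Proof. by have [/(_ N)/issymP/(_ s)] := in_vars_symfun f. Qed.

Lemma in_vars_drop N f : drop_last (in_vars f N.+1) = in_vars f N.
Proof. by have [_ ->] := in_vars_symfun f. Qed.

Lemma mcoeff_in_vars_widen N f m :
  (in_vars f N.+1)@_(mnmwiden m) = (in_vars f N)@_m.
Proof. by rewrite -mcoeff_drop_last in_vars_drop. Qed.

Definition deg_le (d : nat) f := forall N, (msize (in_vars f N) <= d.+1)%N.

Lemma deg_le_mcoeff d f N m : deg_le d f -> (d < mdeg m)%N -> (in_vars f N)@_m = 0.
Proof.
move=> fd dm; apply: memN_msupp_eq0; apply: msize_mdeg_ge.
exact: leq_trans (fd N) _.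
Qed.

Lemma deg_le_exists f : exists d, deg_le d f.
Proof.
have [_ _ [d fd]] := in_vars_symfun f; exists d => N.
exact: leq_trans (fd N) _.
Qed.

Lemma deg_leP d f :
  (forall N m, (d < mdeg m)%N -> (in_vars f N)@_m = 0) -> deg_le d f.
Proof.
move=> fd N; rewrite msizeE; apply/bigmax_leqP_seq => m + _.
rewrite mcoeff_msupp ltnS leqNgt; apply: contra => /fd ->; exact: eqxx.
Qed.

Lemma deg_leW d d' f : (d <= d')%N -> deg_le d f -> deg_le d' f.
Proof. by move=> dd fd N; apply: leq_trans (fd N) _. Qed.

Lemma deg_leD d f g : deg_le d f -> deg_le d g -> deg_le d (f + g).
Proof.
by move=> fd gd N; apply: (leq_trans (msizeD_le _ _)); rewrite geq_max fd gd.
Qed.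

Lemma deg_le0 d : deg_le d (0 : symfun K).
Proof. by move=> N; rewrite in_vars0 msize0. Qed.

Lemma deg_leZ d a f : deg_le d f -> deg_le d (a *: f).
Proof. by move=> fd N; apply: (leq_trans (msizeZ_le _ _)). Qed.

Lemma deg_le_sum d I (r : seq I) (P : pred I) (F : I -> symfun K) :
  (forall i, P i -> deg_le d (F i)) -> deg_le d (\sum_(i <- r | P i) F i).
Proof. by move=> Fd; elim/big_ind: _ => //; [apply: deg_le0|apply: deg_leD]. Qed.

Lemma deg_leM d e f g : deg_le d f -> deg_le e g -> deg_le (d + e) (f * g).
Proof.
move=> fd ge; apply: deg_leP => N m; rewrite ltnNge in_varsM.
apply: contraNeq; rewrite -mcoeff_msupp => /msuppM_le/allpairsP[[m1 m2] /= [m1f m2g ->]].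
rewrite mdegD leq_add // -ltnS.
  exact: leq_trans (msize_mdeg_lt m1f) (fd N).
exact: leq_trans (msize_mdeg_lt m2g) (ge N).
Qed.

Lemma deg_le1 : deg_le 0 (1 : symfun K).
Proof. by move=> N; rewrite in_vars1 msize1. Qed.

Lemma deg_le_prod I (r : seq I) (F : I -> symfun K) (d : I -> nat) :
  (forall i, deg_le (d i) (F i)) ->
  deg_le (\sum_(i <- r) d i) (\prod_(i <- r) F i).
Proof.
move=> Fd; elim: r => [|i r IH]; first by rewrite !big_nil; apply: deg_le1.
by rewrite !big_cons; apply: deg_leM.
Qed.

Lemma deg_le_mono_sum d phi : deg_le d (mono_sum (K := K) d phi).
Proof. by apply: deg_leP => N m dm; rewrite mcoeff_mono_sum leqNgt dm. Qed.

(* A monomial of degree at most N involves at most N variables. *)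
Lemma deg_le_eq0 d N f : deg_le d f -> (d <= N)%N -> in_vars f N = 0 -> f = 0.
Proof.
move=> fd dN fN0.
have down k : forall M, (M + k)%N = N -> in_vars f M = 0.
  elim: k => [|k IH] M; first by rewrite addn0 => ->.
  rewrite addnS -addSn => /IH f0; apply/mpolyP => m.
  by rewrite -mcoeff_in_vars_widen f0 !mcoeff0.
have up k : in_vars f (k + N)%N = 0.
  elim: k => [//|k IH]; rewrite addSn; apply/mpolyP => m; rewrite mcoeff0.
  have [dm|md] := ltnP d (mdeg m); first exact: deg_le_mcoeff fd dm.
  have /existsP[i /eqP mi0] : [exists i, m i == 0%N].
    apply: contraLR md; rewrite negb_exists => /forallP m0.
    rewrite -ltnNge mdegE.
    apply: (@leq_trans (\sum_(i < (k + N).+1) 1)).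
      by rewrite sum1_card card_ord ltnS (leq_trans dN) // leq_addl.
    by apply: leq_sum => i _; rewrite lt0n; apply: m0.
  rewrite -(in_vars_sym f (tperm i ord_max)) mcoeff_sym.
  set m' := m#_.
  suff -> : m' = mnmwiden [multinom m' (widen_ord (leqnSn _) j) | j < k + N].
    by rewrite mcoeff_in_vars_widen IH mcoeff0.
  apply/mnmP => j; have [->|] := eqVneq j ord_max.
    by rewrite mnmwiden_ordmax /m' mnmE tpermR.
  case: (unliftP ord_max j) => [j' ->|-> /eqP//] _.
  have -> : lift ord_max j' = widen_ord (leqnSn _) j'.
    by apply: val_inj; rewrite /= /bump leqNgt ltn_ord.
  by rewrite mnmwiden_widen mnmE.
apply: symfunP => M; rewrite in_vars0.
have [MN|/ltnW NM] := leqP M N; first by apply: (down (N - M)%N); rewrite subnKC.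
by rewrite -(subnK NM) up.
Qed.

Lemma deg_le_eq d N f g : deg_le d f -> deg_le d g -> (d <= N)%N ->
  in_vars f N = in_vars g N -> f = g.
Proof.
move=> fd gd dN fg; apply/eqP; rewrite -subr_eq0; apply/eqP.
apply: (deg_le_eq0 (d := d)) dN _.
  by rewrite -scaleN1r; apply: deg_leD => //; apply: deg_leZ.
by rewrite in_varsD in_varsN fg subrr.
Qed.

(** The degree bound built into [mono_sum] is invisible here, since the parts of [m] determine its
    degree. For an unsorted [la] the function [sym_m] is 0. *)
Lemma mcoeff_sym_m la N (m : 'X_{1..N}) :
  (in_vars (sym_m K la) N)@_m = (perm_eq (mnm_part m) la && sorted geq la)%:R.
Proof.
rewrite /sym_m mcoeff_mono_sum.
have E : perm_eq (mnm_part m) la && sorted geq la = (mnm_part m == la).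
  apply/andP/eqP => [[pe so]|<-]; last by rewrite perm_refl (sort_sorted geq_total).
  by apply: (sorted_eq geq_trans geq_anti _ so pe); apply: sort_sorted geq_total _.
rewrite E; case: leqP => // dm; case: eqP => // pm; move: dm.
rewrite -pm ltnNge; case/negP; rewrite /mnm_part sumnE.
rewrite (perm_big _ (permEl (perm_sort _ _))) /= big_filter.
rewrite /mdeg [X in (X <= _)%N](bigID (fun i => i == 0%N)) /=.
by rewrite big1 ?add0n // => i /eqP.
Qed.

End InVars.

Lemma perm_mult_fact la mu : perm_eq la mu -> mult_fact la = mult_fact mu.
Proof.
move=> pe; rewrite /mult_fact (perm_big (undup mu)) /=; last first.
  by apply: perm_undup; apply: perm_mem.
by apply: eq_bigr => i _; move/seq.permP: pe => ->.
Qed.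

Lemma mult_fact_cons a la :
  mult_fact (a :: la) = ((count_mem a la).+1 * mult_fact la)%N.
Proof.
rewrite /mult_fact /=.
have [ala|ala] := boolP (a \in la).
  have au : a \in undup la by rewrite mem_undup.
  rewrite !(bigD1_seq a) ?undup_uniq //= eqxx add1n factS mulnA; congr muln.
  by apply: eq_bigr => i ia; rewrite eq_sym (negbTE ia).
rewrite big_cons /= eqxx add1n (count_memPn ala) mul1n /= mul1n.
rewrite !big_seq; apply: eq_bigr => i; rewrite mem_undup => ila.
by case: eqP ala ila => [->|//] /negbTE ->.
Qed.

(** * Weighted sums over maps from parts to variables *)

Section WSum.
Variables (K : comNzRingType) (N : nat).
Implicit Types (mu : seq nat) (U : seq 'I_N) (m : 'X_{1..N}).

(* With [U] empty, [wsum eps mu U] is the sum, over the maps [c] from the parts of [mu]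
   to the variables, of [prod_i x_(c i)^(mu_i)] weighted by
   [prod_j prod_(k < #|c^-1 j|) (1 + eps k)]; [U] lists the values of [c] already chosen.
   For [eps = -1] only injective maps contribute, for [eps = 1] the weight is
   [prod_j #|c^-1 j|!]. *)
Fixpoint wsum (eps : K) mu U : {mpoly K[N]} :=
  if mu is a :: mu' then
    \sum_j (1 + eps *+ count_mem j U) *: ('X_j ^+ a * wsum eps mu' (j :: U))
  else 1.

Lemma wsum_cons eps a mu U : wsum eps (a :: mu) U =
  \sum_j (1 + eps *+ count_mem j U) *: ('X_j ^+ a * wsum eps mu (j :: U)).
Proof. by []. Qed.

Arguments wsum : simpl never.

Lemma perm_wsum eps mu U V : perm_eq U V -> wsum eps mu U = wsum eps mu V.
Proof.
elim: mu U V => [//|a mu IH] U V UV; rewrite !wsum_cons; apply: eq_bigr => j _.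
by rewrite (seq.permP UV) (IH (j :: U) (j :: V)) // perm_cons.
Qed.

Definition add_part mu a i := set_nth 0%N mu i (a + nth 0%N mu i)%N.

(** The order in which [a] and the head [b] of the list are placed does not matter. If [b] goes
    first, to the variable [k], the weight of [a] at [k] grows by [eps]; the correction
    [eps x_k^(a+b)] is the term where [a] is merged into [b]. *)
Lemma wsum_merge eps a mu U :
  (\sum_j (1 + eps *+ count_mem j U) *: 'X_j ^+ a) * wsum eps mu U
  = wsum eps (a :: mu) U - eps *: \sum_(i < size mu) wsum eps (add_part mu a i) U.
Proof.
elim: mu U => [|b mu IH] U.
  rewrite big_ord0 scaler0 subr0 mulr1 wsum_cons; apply: eq_bigr => j _.
  by rewrite mulr1.
have -> : \sum_(i < size (b :: mu)) wsum eps (add_part (b :: mu) a i) U =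
    \sum_k (1 + eps *+ count_mem k U) *: ('X_k ^+ b * ('X_k ^+ a * wsum eps mu (k :: U)
       + \sum_(i < size mu) wsum eps (add_part mu a i) (k :: U))).
  rewrite big_ord_recl [add_part _ _ _]/= wsum_cons.
  under [X in _ + X]eq_bigr => i _ do
    rewrite -[add_part _ _ _]/(b :: add_part mu a i) wsum_cons.
  rewrite [X in _ + X]exchange_big -big_split; apply: eq_bigr => k _ /=.
  by rewrite -scaler_sumr -mulr_sumr -scalerDr mulrDr mulrA -exprD addnC.
rewrite wsum_cons mulr_sumr.
have -> : wsum eps [:: a, b & mu] U =
   \sum_k (1 + eps *+ count_mem k U) *: ('X_k ^+ b * wsum eps (a :: mu) (k :: U)).
  rewrite wsum_cons; under eq_bigr => j _ do rewrite wsum_cons mulr_sumr scaler_sumr.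
  rewrite exchange_big; apply: eq_bigr => k _.
  rewrite wsum_cons mulr_sumr scaler_sumr; apply: eq_bigr => j _.
  rewrite -!scalerAr !scalerA mulrCA; congr (_ *: (_ * (_ * _))); last first.
    by apply: perm_wsum; apply/seq.permP => p /=; rewrite addnCA.
  rewrite /= [k == j]eq_sym; case: eqP => [->|_] //=.
  by rewrite !add0n mulrC.
rewrite scaler_sumr -sumrB; apply: eq_bigr => k _.
rewrite -scalerAr mulrCA.
have -> : (\sum_j (1 + eps *+ (count_mem j U)) *: 'X_j ^+ a : {mpoly K[N]}) =
   (\sum_j (1 + eps *+ (count_mem j (k :: U))) *: 'X_j ^+ a) - eps *: 'X_k ^+ a.
  rewrite (bigD1 k) //= [in RHS](bigD1 k) //= addrAC; congr (_ + _); last first.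
    by apply: eq_bigr => j jk; rewrite eq_sym (negbTE jk).
  by rewrite eqxx add1n mulrS addrCA -scalerBl [eps + _]addrC addrK.
rewrite mulrBl IH -scalerAl -addrA -opprD -scalerDr mulrBr scalerBr.
congr (_ - _); rewrite -scalerAr !scalerA mulrC; congr (_ *: (_ * _)).
by rewrite addrC.
Qed.

Lemma mcoeffMXn (p : {mpoly K[N]}) j a m :
  ('X_j ^+ a * p)@_m = if (a <= m j)%N then p@_(m - U_(j) *+ a) else 0.
Proof.
rewrite mulrC mpolyXn; case: leqP => [am|ma].
  by rewrite -[in LHS](submMnK am) addmC mcoeffMX.
apply: memN_msupp_eq0; apply/negP => /msuppM_le/allpairsP[[m1 m2] /= [_]].
rewrite msuppX inE => /eqP -> mE; move: ma; rewrite mE.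
by rewrite mnmDE mulmnE mnm1E eqxx mul1n ltnNge leq_addl.
Qed.

Definition mnm_parts m : seq nat := [seq i <- m | i != 0%N].

Lemma mnm_map_enum m : m = [seq m j | j <- enum 'I_N] :> seq nat.
Proof.
rewrite -[LHS]map_tnth_enum; apply: eq_map => j; exact: mnm_tnth.
Qed.

Lemma count_mnm_parts a m : a != 0%N ->
  count_mem a (mnm_parts m) = #|[set j | m j == a]|.
Proof.
move=> a0; rewrite count_filter.
rewrite (eq_count (a2 := pred1 a)); last by move=> i /=; case: eqP => // ->.
rewrite mnm_map_enum count_map cardE {2}/enum_mem size_filter -enumT.
by apply: eq_count => j; rewrite /= inE.
Qed.

Lemma mnm_parts0 m : 0%N \notin mnm_parts m.
Proof. by rewrite mem_filter. Qed.

Lemma perm_mnm_parts_sub a m j : a != 0%N -> m j = a ->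
  perm_eq (mnm_parts m) (a :: mnm_parts (m - U_(j) *+ a)).
Proof.
move=> a0 mja; apply/allP => v _ /=; apply/eqP.
have [->|v0] := eqVneq v 0%N.
  by rewrite (negbTE a0) !(count_memPn (mnm_parts0 _)).
rewrite !count_mnm_parts // (cardsD1 j) inE mja; congr addn.
apply: eq_card => k; rewrite !inE mnmBE mulmnE mnm1E [j == k]eq_sym.
case: eqP => [->|] //=; last by rewrite mul0n subn0.
by rewrite mul1n mja subnn eq_sym (negbTE v0).
Qed.

(** For a duplicate-free [U] the weight is 0 on the variables already chosen and 1 on the others, so
    the coefficient counts the injective placements of the parts that avoid [U]. *)
Lemma mcoeff_wsumN1 mu U m : 0%N \notin mu -> uniq U ->
  (wsum (-1) mu U)@_m =
    (all (fun j => m j == 0%N) U && perm_eq (mnm_parts m) mu)%:R *+ mult_fact mu.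
Proof.
elim: mu U m => [|a mu IH] U m.
  move=> _ _; rewrite mcoeff1 /mult_fact big_nil mulr1n; congr (_%:R); congr nat_of_bool.
  apply/eqP/andP => [->|[_ /perm_nilP m0]].
    split; first by apply/allP => j _; rewrite mnm0E.
    apply/perm_nilP/eqP; rewrite -[_ == _]negbK -has_filter; apply/hasPn => v.
    by rewrite mnm_map_enum => /mapP[j _ ->]; rewrite mnm0E.
  apply/mnmP => j; rewrite mnm0E; apply/eqP; apply: contraT => mj.
  have : m j \in mnm_parts m.
    by rewrite mem_filter mj mnm_map_enum map_f ?mem_enum.
  by rewrite m0.
rewrite inE negb_or => /andP[a0 mu0] uU; rewrite eq_sym in a0.
rewrite wsum_cons raddf_sum /=.
pose b := all (fun j => m j == 0%N) U && perm_eq (mnm_parts m) (a :: mu).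
rewrite (eq_bigr (fun j => (m j == a)%:R * (b%:R *+ mult_fact mu))); last first.
  move=> j _; rewrite mcoeffZ mcoeffMXn.
  have [jU|jU] := boolP (j \in U).
    rewrite count_uniq_mem // jU subrr mul0r /b.
    case: eqP => [mja|]; last by rewrite mul0r.
    suff /negbTE -> : ~~ all (fun k => m k == 0%N) U by rewrite mul0rn mulr0.
    by apply/allPn; exists j; rewrite ?mja.
  rewrite (count_memPn jU) mulr0n addr0 mul1r.
  have [mja|] := eqVneq (m j) a; last first.
    (* If [m j > a], the remaining exponent of [x_j] is positive although [j] has now been used. *)
    move=> mja; rewrite mul0r; case: leqP => // am.
    rewrite IH //= ?jU // mnmBE mulmnE mnm1E eqxx mul1n subn_eq0 leqNgt.
    by rewrite ltn_neqAle eq_sym mja am /= mul0rn.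
  rewrite mja leqnn mul1r IH //= ?jU // mnmBE mulmnE mnm1E eqxx mul1n mja subnn /=.
  congr (_%:R *+ _); rewrite /b (permPl (perm_mnm_parts_sub a0 mja)) perm_cons.
  congr (nat_of_bool (_ && _)).
  apply: eq_in_all => k kU; rewrite mnmBE mulmnE mnm1E.
  by have [jk|_] := eqVneq j k; [rewrite jk kU in jU|rewrite mul0n subn0].
rewrite -big_distrl /= -natr_sum mult_fact_cons.
rewrite (eq_bigr (fun j => if m j == a then 1 else 0)%N); last by move=> j _; case: eqP.
rewrite -big_mkcond sum1_card /= -[#|_|]cardsE -count_mnm_parts // -/b.
rewrite mulr_natl mulnC mulrnA.
have [] := boolP b => [/andP[_ pe]|_]; last by rewrite /= !mul0rn.
by rewrite (seq.permP pe) /= eqxx add1n.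
Qed.
End WSum.
Arguments wsum : simpl never.

Section Augmented.
Variable K : comNzRingType.
Implicit Types (mu : seq nat) (N a i j k : nat).

(** The augmented monomial function. Merging parts destroys their order, hence the sorting. *)
Definition aug mu : symfun K := sym_m K (sort geq mu) *+ mult_fact mu.

Lemma perm_aug mu la : perm_eq mu la -> aug mu = aug la.
Proof.
move=> pe; rewrite /aug (perm_mult_fact pe).
suff -> : sort geq mu = sort geq la by [].
exact/(perm_sortP geq_total geq_trans geq_anti).
Qed.

Lemma aug_in_vars mu N : 0%N \notin mu -> in_vars (aug mu) N = wsum (-1) mu [::].
Proof.
move=> mu0; apply/mpolyP => m; rewrite mcoeff_wsumN1 //=.
rewrite /aug in_varsMn mcoeffMn mcoeff_sym_m (sort_sorted geq_total) andbT.
by rewrite perm_sort perm_sym perm_sort perm_sym.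
Qed.

Lemma in_vars_p1 k N : k != 0%N ->
  in_vars (sym_p1 K k) N = \sum_(i < N) 'X_i ^+ k.
Proof.
move=> k0; have -> : sym_p1 K k = aug [:: k].
  by rewrite /aug /mult_fact /= big_seq1 /= eqxx mulr1n.
rewrite aug_in_vars ?inE 1?eq_sym //; apply: eq_bigr => i _.
by rewrite mulr0n addr0 scale1r mulr1.
Qed.

Lemma aug0 : aug [::] = 1.
Proof. by apply: symfunP => N; rewrite aug_in_vars. Qed.

Lemma add_part_pos a mu (i : 'I_(size mu)) : a != 0%N -> 0%N \notin mu ->
  0%N \notin add_part mu a i.
Proof.
move=> a0 mu0; apply: contra a0 => /(nthP 0%N)[k].
rewrite size_set_nth (maxn_idPr (ltn_ord i)) => km.
rewrite nth_set_nth /=; case: eqP => [_|_ mk].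
  by move/eqP; rewrite addn_eq0 => /andP[].
by rewrite -mk mem_nth in mu0.
Qed.

Lemma aug_cons a mu : a != 0%N -> 0%N \notin mu ->
  aug (a :: mu) = sym_p1 K a * aug mu - \sum_(i < size mu) aug (add_part mu a i).
Proof.
move=> a0 mu0; apply: symfunP => N.
have am0 (i : 'I_(size mu)) := add_part_pos i a0 mu0.
rewrite in_varsD in_varsN in_varsM in_vars_sum in_vars_p1 // !aug_in_vars //; last first.
  by rewrite inE negb_or eq_sym a0.
under [X in _ - X]eq_bigr => i _ do rewrite aug_in_vars //.
have -> : \sum_(i < N) 'X_i ^+ a =
    \sum_(j < N) (1 + -1 *+ count_mem j [::]) *: 'X_j ^+ a :> {mpoly K[N]}.
  by apply: eq_bigr => j _; rewrite mulr0n addr0 scale1r.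
by rewrite wsum_merge scaleN1r opprK addrK.
Qed.

Lemma aug_nseq1 j : aug (nseq j 1%N) = sym_e1 K j *+ j`!.
Proof.
rewrite /aug /sym_e1 (sorted_sort geq_trans); last by elim: j => // -[].
congr (_ *+ _).
elim: j => [|j IH]; first by rewrite /mult_fact big_nil.
by rewrite [nseq _ _]/= mult_fact_cons IH count_nseq /= mul1n factS.
Qed.

Lemma sym_e10 : sym_e1 K 0 = 1.
Proof. by rewrite -aug0 -[[::]]/(nseq 0 1%N) aug_nseq1 mulr1n. Qed.

Lemma mcoeff_h1 k N (m : 'X_{1..N}) : (in_vars (sym_h1 K k) N)@_m = (mdeg m == k)%:R.
Proof.
rewrite /sym_h1 mcoeff_mono_sum.
have -> : sumn (mnm_part m) = mdeg m.
  rewrite /mnm_part sumnE (perm_big _ (permEl (perm_sort _ _))) /= big_filter.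
  rewrite /mdeg [RHS](bigID (fun i => i == 0%N)) /=.
  by rewrite [X in _ = (X + _)%N]big1 ?add0n // => i /eqP.
by case: leqP => //; rewrite ltn_neqAle eq_sym => /andP[/negbTE->].
Qed.

Lemma sym_h10 : sym_h1 K 0 = 1.
Proof.
by apply: symfunP => N; apply/mpolyP => m; rewrite mcoeff_h1 mcoeff1 mdeg_eq0.
Qed.

(** On a monomial of degree [k.+1], the right-hand side counts the pairs of a variable [j] and an
    [i < m j]; there are [mdeg m] of them. *)
Lemma newton_h k :
  sym_h1 K k.+1 *+ k.+1 = \sum_(i < k.+1) sym_p1 K i.+1 * sym_h1 K (k - i).
Proof.
apply: symfunP => N; apply/mpolyP => m.
rewrite in_varsMn mcoeffMn mcoeff_h1 in_vars_sum raddf_sum /=.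
have E (i : 'I_k.+1) : (in_vars (sym_p1 K i.+1 * sym_h1 K (k - i)) N)@_m =
    (mdeg m == k.+1)%:R *+ \sum_(j < N) (i < m j)%N.
  rewrite in_varsM in_vars_p1 // mulr_suml raddf_sum /= -sumrMnr.
  apply: eq_bigr => j _; rewrite mcoeffMXn mcoeff_h1.
  case: ltnP => // ij; rewrite mulr1n; congr (_%:R); congr nat_of_bool.
  rewrite -{2}(submMnK ij) mdegD mdegMn mdeg1 mul1n.
  have ik : (k - i + i.+1)%N = k.+1 by rewrite addnS subnK // -ltnS.
  by rewrite -[X in (_ + _ == X)%N]ik eqn_add2r.
under eq_bigr => i _ do rewrite E.
rewrite sumrMnr exchange_big /=.
have [mk|] := eqVneq (mdeg m) k.+1; last by rewrite !mul0rn.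
congr (_ *+ _); transitivity (mdeg m) => //; rewrite mdegE; apply: eq_bigr => j _.
have mjk : (m j <= k.+1)%N by rewrite -mk mdegE (bigD1 j) //= leq_addr.
rewrite (eq_bigr (fun i : 'I_k.+1 => if (i < m j)%N then 1%N else 0%N)); last first.
  by move=> i _; case: (_ < _)%N.
rewrite -big_mkcond /=.
by rewrite -(big_ord_widen _ (fun=> 1%N) mjk) sum1_card card_ord.
Qed.

End Augmented.

(** * The involution omega on power sums and augmented monomials *)

Section Omega.
Variable K : numFieldType.
Implicit Types (mu : seq nat) (N a i j k : nat).

Lemma mulrnI_symfun n (f g : symfun K) : (0 < n)%N -> f *+ n = g *+ n -> f = g.
Proof.
move=> n0 fg; apply: (scalerI (a := n%:R : K)); first by rewrite pnatr_eq0 -lt0n.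
by rewrite !scaler_nat.
Qed.

(* The augmented monomials of hook shapes interpolate between [p_k] and [e_k]. *)
Lemma aug_hook a j : a != 0%N ->
  aug K (a :: nseq j 1%N)
  = (\sum_(i < j.+1) (-1) ^+ i *: (sym_p1 K (a + i)%N * sym_e1 K (j - i))) *+ j`!.
Proof.
elim: j a => [|j IH] a a0.
  rewrite big_ord1 aug_cons // big_ord0 subr0 aug0 mulr1 expr0 scale1r addn0.
  by rewrite sym_e10 mulr1.
rewrite aug_cons //; last by rewrite mem_nseq negb_and.
(* Merging [a] into any of the [j.+1] ones gives the same hook, up to the order of the parts. *)
rewrite (eq_bigr (fun=> aug K (a.+1 :: nseq j 1%N))); last first.
  move=> i _; apply: perm_aug; apply/allP => v _ /=.
  have il : (i < size (nseq j.+1 1%N))%N by exact: ltn_ord.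
  have il' : (i < j.+1)%N by rewrite -[X in (_ < X)%N](size_nseq j.+1 1%N).
  rewrite /add_part -[1%N :: nseq j 1%N]/(nseq j.+1 1%N).
  rewrite count_set_nth_ltn // !nth_nseq il' /= addn1 !count_nseq /=.
  by rewrite -addnA addKn addnC.
rewrite sumr_const card_ord size_nseq IH // -mulrnA [(j`! * _)%N]mulnC -factS.
rewrite aug_nseq1 mulrnAr -mulrnBl; congr (_ *+ _).
rewrite [RHS]big_ord_recl expr0 scale1r addn0 subn0 -sumrN; congr (_ + _).
apply: eq_bigr => i _; rewrite -scaleNr -mulN1r -exprS /=.
by rewrite /bump /= add1n subSS addnS addSn.
Qed.

(** The hook with [a = 1] is a column of ones, for which [aug_hook] is [k!] times this identity. *)
Lemma newton_e k : sym_e1 K k.+1 *+ k.+1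
  = \sum_(i < k.+1) (-1) ^+ i *: (sym_p1 K i.+1 * sym_e1 K (k - i)).
Proof.
apply: (@mulrnI_symfun k`!); first exact: fact_gt0.
by rewrite -mulrnA -factS -aug_nseq1 [nseq _ _]/= aug_hook.
Qed.

Variable omega : {lrmorphism symfun K -> symfun K}.
Hypothesis omegaP : is_omega omega.

Lemma omega_e1 k : omega (sym_e1 K k) = sym_h1 K k.
Proof.
case: k => [|k]; first by rewrite sym_e10 sym_h10 rmorph1.
by have := omegaP.2 [:: k.+1] isT; rewrite /sym_e /sym_h !big_seq1.
Qed.

(** The image of [newton_e] under [omega] is compared with [newton_h]: by induction all terms agree
    except the last ones, which must then agree too. *)
Lemma omega_p1 k : omega (sym_p1 K k.+1) = (-1) ^+ k *: sym_p1 K k.+1.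
Proof.
elim/ltn_ind: k => k IH.
have := newton_h K k; rewrite -omega_e1 -rmorphMn newton_e rmorph_sum /=.
rewrite big_ord_recr [RHS]big_ord_recr /=.
rewrite subnn sym_e10 sym_h10 !mulr1 linearZ.
rewrite (eq_bigr (fun i : 'I_k => sym_p1 K i.+1 * sym_h1 K (k - i))).
  by move/addrI/(congr1 ( *:%R ((-1) ^+ k))); rewrite scalerA -expr2 sqrr_sign scale1r.
move=> i _; rewrite linearZ /= rmorphM /= omega_e1 IH // -scalerAl scalerA.
by rewrite -expr2 sqrr_sign scale1r.
Qed.

(** Merging keeps the sum of the parts and lowers their number by one, so the sign turns the
    recursion [aug_cons] into that of [wsum_merge] for [eps = 1]; the sign of [omega_p1] accounts
    for the factor [p_a]. The induction is on the number of parts because a merged list is not a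
    tail. *)
Lemma in_vars_omega_aug mu N : 0%N \notin mu ->
  in_vars ((-1) ^+ (sumn mu - size mu) *: omega (aug K mu)) N = wsum 1 mu [::].
Proof.
have [l] := ubnP (size mu); elim: l mu => // l IH [|a mu] /=.
  by move=> _ _; rewrite aug0 rmorph1 scale1r.
rewrite ltnS => sl; rewrite inE negb_or eq_sym => /andP[a0 mu0].
have smu : (size mu <= sumn mu)%N.
  elim: mu mu0 {sl} => //= b mu IHmu; rewrite inE negb_or eq_sym -lt0n => /andP[b0 /IHmu].
  exact: leq_add b0.
have am0 (i : 'I_(size mu)) := add_part_pos i a0 mu0.
have size_am (i : 'I_(size mu)) : size (add_part mu a i) = size mu.
  by rewrite size_set_nth (maxn_idPr (ltn_ord i)).
have sumn_am (i : 'I_(size mu)) : sumn (add_part mu a i) = (a + sumn mu)%N.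
  by rewrite sumn_set_nth_ltn // addnA addnK addnC.
have psumE : \sum_(j < N) (1 + (1 : K) *+ count_mem j [::]) *: 'X_j ^+ a
    = in_vars (sym_p1 K a) N.
  by rewrite in_vars_p1 //; apply: eq_bigr => j _; rewrite mulr0n addr0 scale1r.
have := wsum_merge (1 : K) a mu ([::] : seq 'I_N).
rewrite psumE scale1r => /eqP; rewrite eq_sym subr_eq => /eqP ->.
rewrite aug_cons // rmorphB /= rmorphM /= rmorph_sum scalerBr -scalerN in_varsD.
case: a a0 {psumE} am0 size_am sumn_am => // a _ am0 size_am sumn_am.
congr (_ + _).
  rewrite omega_p1 -scalerAl scalerA addSn subSS -IH // -in_varsM -scalerAr.
  congr (in_vars _ N); congr (_ *: _).
  by rewrite -addnBA // exprD mulrAC -expr2 sqrr_sign mul1r.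
rewrite -sumrN scaler_sumr in_vars_sum; apply: eq_bigr => i _.
rewrite -IH ?size_am // sumn_am scalerN -scaleNr; congr (in_vars _ N); congr (_ *: _).
by rewrite !addSn subSS subSn ?exprS ?mulN1r // (leq_trans smu) ?leq_addl.
Qed.

End Omega.

(** * Alternants and the Jacobi-Trudi identity *)

Section Alternants.
Variables (K : numFieldType) (N : nat).
Implicit Types (m : 'X_{1..N}) (s : 'S_N) (P Q f : {mpoly K[N]}).

Definition alt m : {mpoly K[N]} := \det (\matrix_(i < N, j < N) 'X_j ^+ m i).

Lemma alternantE (alpha : nat -> nat) :
  alternant K N alpha = alt [multinom alpha i | i < N].
Proof. by congr (\det _); apply/matrixP => i j; rewrite !mxE mnmE. Qed.

Lemma altE m : alt m = \sum_(s : 'S_N) (-1) ^+ s *: 'X_[m # s].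
Proof.
rewrite /alt /determinant (reindex_inj invg_inj); apply: eq_bigr => s _.
rewrite odd_permV mulr_sign scaler_sign.
suff -> : \prod_i (\matrix_(i0 < N, j < N) ('X_j ^+ m i0 : {mpoly K[N]})) i ((s^-1)%g i)
   = 'X_[m # s] by [].
rewrite (mpolyXE _ (s^-1)%g); apply: eq_bigr => i _.
by rewrite !mxE mnmE permKV.
Qed.

Definition antisym P := forall s, msym s P = (-1) ^+ s *: P.

Lemma antisym_mcoeff P s m : antisym P -> P@_(m # s) = (-1) ^+ s * P@_m.
Proof. by move=> aP; rewrite -mcoeff_sym aP mcoeffZ. Qed.

Lemma antisymP P : (forall s m, P@_(m # s) = (-1) ^+ s * P@_m) -> antisym P.
Proof. by move=> aP s; apply/mpolyP => m; rewrite mcoeff_sym aP mcoeffZ. Qed.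

Lemma antisymM f P : f \is symmetric -> antisym P -> antisym (f * P).
Proof. by move=> /issymP fs aP s; rewrite msymM fs aP scalerAr. Qed.

(** Transposing two equal exponents shows that the coefficient is its own opposite. *)
Lemma antisym_inj P m : antisym P -> P@_m != 0 -> injective m.
Proof.
move=> aP Pm i j mij; apply/eqP; apply: contraNT Pm => ij.
have := antisym_mcoeff (tperm i j) m aP.
have -> : m # (tperm i j) = m.
  by apply/mnmP => k; rewrite mnmE; case: tpermP => // ->.
rewrite odd_tperm ij mulN1r => /eqP.
by rewrite -addr_eq0 -mulr2n mulrn_eq0.
Qed.

Lemma mpermMs m (s t : 'S_N) : m # (s * t)%g = (m # t) # s.
Proof. by apply/mnmP => i; rewrite !mnmE permM. Qed.

Lemma mperm_id m : m # (1 : 'S_N)%g = m.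
Proof. by apply/mnmP => i; rewrite mnmE perm1. Qed.

Lemma mcoeff_alt m k : (alt m)@_k = \sum_(s : 'S_N) (-1) ^+ s *+ (m # s == k).
Proof.
by rewrite altE raddf_sum /=; apply: eq_bigr => s _; rewrite mcoeffZ mcoeffX mulr_natr.
Qed.

Lemma antisym_alt m : antisym (alt m).
Proof.
apply: antisymP => s k; rewrite !mcoeff_alt.
rewrite (reindex_inj (mulgI s)) /= mulr_sumr; apply: eq_bigr => t _.
rewrite odd_permM signr_addb mulrnAr mpermMs; congr (_ *+ nat_of_bool _).
apply/eqP/eqP => [/mnmP e|<- //]; apply/mnmP => i.
by have := e ((s^-1)%g i); rewrite !mnmE permKV.
Qed.

Lemma mcoeff_alt_neq0 m k : (alt m)@_k != 0 -> exists s : 'S_N, m # s = k.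
Proof.
rewrite mcoeff_alt => nz; suff /existsP[s /eqP sm] : [exists s : 'S_N, m # s == k] by exists s.
by apply: contraNT nz => /existsPn z; rewrite big1 // => s _; rewrite (negbTE (z s)).
Qed.

(** The sum runs over the whole support rather than over one representative per orbit, whence the
    factor [N!]. *)
Lemma antisym_expand P : antisym P ->
  N`!%:R *: P = \sum_(m <- msupp P) P@_m *: alt m.
Proof.
move=> aP; apply/mpolyP => k; rewrite mcoeffZ raddf_sum /=.
under eq_bigr => m _ do rewrite mcoeffZ mcoeff_alt mulr_sumr.
rewrite exchange_big /= -[in LHS](card_Sn N) -sum1_card natr_sum mulr_suml.
apply: eq_bigr => s _; rewrite mul1r.
have E m : (m # s == k) = (m == k # (s^-1)%g).
  by apply/eqP/eqP => [<-|->]; rewrite -mpermMs ?mulVg ?mulgV mperm_id.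
under eq_bigr => m _ do rewrite E mulrnAr -mulrnAl.
by rewrite -mulr_suml mcoeff_msupp_sum antisym_mcoeff // odd_permV mulrAC -expr2 sqrr_sign mul1r.
Qed.

Lemma alt_inj m : injective m -> (alt m)@_m = 1.
Proof.
move=> mI; rewrite mcoeff_alt (bigD1 1%g) //= mperm_id eqxx odd_perm1 big1 ?addr0 // => s s1.
case: eqP => // ms; case/eqP: s1; apply/permP => i; rewrite perm1.
by apply: mI; rewrite -[in RHS]ms mnmE.
Qed.

Definition mdelta : 'X_{1..N} := [multinom (N.-1 - i)%N | i < N].

Lemma mdelta_inj : injective mdelta.
Proof.
move=> i j; rewrite !mnmE => /eqP; have := ltn_ord i; have := ltn_ord j.
case: N i j => [[]//|n] i j /=; rewrite !ltnS => jn i_n.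
by rewrite eqn_sub2lE // => /eqP ij; apply: val_inj.
Qed.

Lemma alt_mdelta_neq0 : alt mdelta != 0.
Proof.
apply/eqP => a0; have := alt_inj mdelta_inj; rewrite a0 mcoeff0 => /eqP.
by rewrite eq_sym oner_eq0.
Qed.
End Alternants.

Section CompleteIn.
Variables (K : comNzRingType) (N : nat).
Implicit Types (A : {set 'I_N}) (i j : 'I_N) (m : 'X_{1..N}) (k d : nat).

Definition complete_in A k : {mpoly K[N]} :=
  \sum_(m : 'X_{1..N < k.+1} |
         (mdeg m == k) && [forall j, (j \notin A) ==> (m j == 0%N)]) 'X_[m].

Lemma mcoeff_complete_in A k m : (complete_in A k)@_m =
  ((mdeg m == k) && [forall j, (j \notin A) ==> (m j == 0%N)])%:R.
Proof.
rewrite /complete_in raddf_sum /=; under eq_bigr => m' _ do rewrite mcoeffX.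
have [mk|mk] := ltnP (mdeg m) k.+1; last first.
  rewrite gtn_eqF //= big1 // => m' _; case: eqP => // mm.
  by have := bmdeg m'; rewrite mm ltnNge mk.
set b := (_ && _).
rewrite big_mkcond (bigD1 (BMultinom mk)) //= eqxx big1 ?addr0.
  by rewrite -/b; case: b.
move=> m' /eqP mm; case: ifP => // _; case: eqP => // e; case: mm.
exact: val_inj.
Qed.

Lemma complete_in_rec A i k : i \in A ->
  complete_in A k.+1 - 'X_i * complete_in A k = complete_in (A :\ i) k.+1.
Proof.
move=> iA; apply/mpolyP => m; rewrite mcoeffB -['X_i]expr1 mcoeffMXn !mcoeff_complete_in.
rewrite mulm1n; case: ltnP => [mi|]; last first.
  rewrite leqn0 => /eqP mi; rewrite subr0; congr (nat_of_bool (_ && _))%:R.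
  apply: eq_forallb => j; rewrite !inE negb_and negbK.
  by have [->|_] := eqVneq j i; rewrite ?mi ?eqxx ?implybT.
have e : (m - U_(i) + U_(i))%MM = m.
  apply: submK; apply/mnm_lepP => l; rewrite mnm1E; case: eqP => // <-; exact: mi.
have -> : (mdeg (m - U_(i)) == k) = (mdeg m == k.+1).
  by rewrite -{2}e mdegD mdeg1 addn1 eqSS.
have -> : [forall j, (j \notin A :\ i) ==> (m j == 0%N)] = false.
  by apply/negbTE/forallPn; exists i; rewrite !inE eqxx /= -lt0n.
rewrite andbF; apply/eqP; rewrite subr_eq0; apply/eqP.
congr (nat_of_bool (_ && _))%:R; apply: eq_forallb => j.
by rewrite mnmBE mnm1E; have [<-|_] := eqVneq i j; rewrite ?iA ?subn0.
Qed.

Lemma complete_in0 A : complete_in A 0 = 1.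
Proof.
apply/mpolyP => m; rewrite mcoeff_complete_in mcoeff1 mdeg_eq0.
case: eqP => // ->.
suff -> : [forall j, (j \notin A) ==> ((0%MM : 'X_{1..N}) j == 0%N)] by [].
by apply/forallP => j; rewrite mnm0E eqxx implybT.
Qed.

Lemma complete_in1 j k : complete_in [set j] k = 'X_j ^+ k.
Proof.
apply/mpolyP => m; rewrite mcoeff_complete_in mpolyXn mcoeffX; congr (_%:R); congr nat_of_bool.
apply/andP/eqP => [[/eqP <- /forallP mj]|<-].
  apply/mnmP => i; rewrite mulmnE mnm1E; case: eqP => [<-|/eqP ji].
    rewrite mul1n mdegE (bigD1 j) //= big1 ?addn0 // => l lj.
    by have := mj l; rewrite inE lj => /eqP.
  by have := mj i; rewrite inE eq_sym ji => /eqP ->.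
rewrite mdegMn mdeg1 mul1n eqxx; split => //; apply/forallP => i.
by rewrite inE mulmnE mnm1E [j == i]eq_sym; case: eqP.
Qed.

(** The generating series of the complete homogeneous polynomials in the variables of [A],
    truncated: only coefficients below [d] are meaningful. *)
Definition complete_poly d A : {poly {mpoly K[N]}} := \poly_(k < d) complete_in A k.

Definition linfac i : {poly {mpoly K[N]}} := 1 - 'X_i *: 'X.

Lemma coef_linfacM i (p : {poly {mpoly K[N]}}) k :
  (linfac i * p)`_k = p`_k - (if k is l.+1 then 'X_i * p`_l else 0).
Proof.
rewrite /linfac mulrBl mul1r coefB -scalerAl coefZ coefXM.
by case: k => [|k]; rewrite ?mulr0.
Qed.

(* Multiplying the generating series of the [complete_in A k] by [1 - x_i t] removes
   the variable [x_i] from [A]. *)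
Lemma coef_prod_linfac d (r : seq 'I_N) A k : uniq r -> {subset r <= A} -> (k < d)%N ->
  ((\prod_(i <- r) linfac i) * complete_poly d A)`_k = complete_in (A :\: [set i in r]) k.
Proof.
elim: r k => [|i r IH] k /=.
  move=> _ _ kd; rewrite big_nil mul1r coef_poly kd; congr complete_in.
  by apply/setP => j; rewrite !inE.
case/andP=> ir ur rA kd; rewrite big_cons -mulrA coef_linfacM.
have rA' : {subset r <= A} by move=> j jr; apply: rA; rewrite inE jr orbT.
have -> : A :\: [set j in i :: r] = (A :\: [set j in r]) :\ i.
  by apply/setP => j; rewrite !inE negb_or; case: (j == i).
rewrite IH //; case: k kd => [|k] kd; first by rewrite subr0 !complete_in0.
rewrite IH //; last exact: ltnW.
by rewrite complete_in_rec // !inE ir rA // inE eqxx.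
Qed.

Lemma size_prod_linfac (r : seq 'I_N) :
  (size (\prod_(i <- r) linfac i)%R <= (size r).+1)%N.
Proof.
elim: r => [|i r IH]; first by rewrite big_nil size_poly1.
rewrite big_cons; apply: leq_trans (size_polyMleq _ _) _.
have : (size (linfac i) <= 2)%N.
  rewrite /linfac; apply: leq_trans (size_polyD _ _) _.
  rewrite geq_max size_poly1 size_polyN /=.
  by apply: leq_trans (size_scale_leq _ _) _; rewrite size_polyX.
move=> sl; have := leq_add sl IH; rewrite /= !addSn add0n.
by case: (_ + _)%N.
Qed.

(** Up to the sign [(-1)^k], the elementary symmetric polynomial of degree [k] in the variables
    other than [x_j]. *)
Definition jt_coef j k : {mpoly K[N]} := (\prod_(i | i != j) linfac i)`_k.

(* The coefficients [jt_coef] do not depend on [a]: this factors the matrix of an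
   alternant as a matrix of complete symmetric functions times a fixed matrix. *)
Lemma power_complete j (a : nat) : 'X_j ^+ a =
  \sum_(k < N) (if (N.-1 - k <= a)%N then complete_in setT (a - (N.-1 - k)) else 0) *
     jt_coef j (N.-1 - k) :> {mpoly K[N]}.
Proof.
(* Once the variables of [r] are removed only [x_j] is left, and its complete polynomial of degree
   [a] is [x_j^a]. *)
pose r := [seq i <- index_enum 'I_N | i != j].
have rU : uniq r by rewrite filter_uniq ?index_enum_uniq.
have := coef_prod_linfac rU (A := setT) (fun i _ => in_setT i) (ltnSn a).
have -> : setT :\: [set i in r] = [set j].
  by apply/setP => i; rewrite !inE mem_filter mem_index_enum !andbT negbK.
rewrite complete_in1 => <-; rewrite coefM.
have jtE k : (\prod_(i <- r) linfac i)`_k = jt_coef j k by rewrite big_filter.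
have jt0 k : (N.-1 < k)%N -> jt_coef j k = 0.
  move=> Nk; rewrite /jt_coef -big_filter; apply: nth_default.
  apply: leq_trans (size_prod_linfac _) _.
  suff -> : size r = N.-1 by [].
  by rewrite size_filter -sum1_count sum1_card cardC1 card_ord.
pose g l := if (l <= a)%N then jt_coef j l * complete_in setT (a - l) else 0.
have Ng (l : nat) : (N <= l)%N -> g l = 0.
  move=> Nl; rewrite /g; case: ifP => // _; rewrite jt0 ?mul0r //.
  by rewrite (leq_trans _ Nl) // prednK // (leq_ltn_trans _ (ltn_ord j)).
(* Both sums extend to a common range: [g l] vanishes for [l > a] by its test, and for [l >= N]
   because a product of [N - 1] linear factors has no such coefficient. *)
transitivity (\sum_(l < a.+1 + N) g l).
  transitivity (\sum_(l < a.+1) g l).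
    apply: eq_bigr => l _; rewrite jtE /g -ltnS ltn_ord; congr (_ * _).
    by rewrite coef_poly ltnS leq_subr.
  rewrite (big_ord_widen _ g (leq_addr N a.+1)) [RHS](bigID (fun l : 'I_ _ => (l < a.+1)%N)) /=.
  by rewrite [X in _ = _ + X]big1 ?addr0 // => l; rewrite /g ltnS => /negbTE ->.
rewrite (bigID (fun l : 'I_ _ => (l < N)%N)) /= [X in _ + X]big1 ?addr0; last first.
  by move=> l; rewrite -leqNgt => /Ng.
rewrite -(big_ord_widen _ g (leq_addl a.+1 N)) (reindex_inj rev_ord_inj) /=.
apply: eq_bigr => k _; rewrite /g subnS -predn_sub.
by case: leqP => _; rewrite ?mul0r // mulrC.
Qed.
End CompleteIn.

Section JacobiTrudi.
Variables (K : numFieldType).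
Implicit Types (la : seq nat) (a b k N : nat).

(* [h_(a-b)], with the convention [h_k = 0] for [k < 0]. *)
Definition hsub a b : symfun K := if (b <= a)%N then sym_h1 K (a - b) else 0.

(** The Jacobi-Trudi determinant, indexed by the shifted vector [m i = la_i + N - 1 - i]. It makes
    sense for every exponent vector and is alternating in it, like [alt]. *)
Definition jt N (m : 'X_{1..N}) : symfun K :=
  \det (\matrix_(i < N, k < N) hsub (m i) (N.-1 - k)).

Lemma in_vars_h1 k N : in_vars (sym_h1 K k) N = complete_in K setT k.
Proof.
apply/mpolyP => m; rewrite mcoeff_h1 mcoeff_complete_in.
suff -> : [forall j, (j \notin [set: 'I_N]) ==> (m j == 0%N)] by rewrite andbT.
by apply/forallP => j; rewrite inE.
Qed.

Lemma in_vars_det N n (A : 'M[symfun K]_n) :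
  in_vars (\det A) N = \det (map_mx (fun f => in_vars f N) A).
Proof.
rewrite /determinant in_vars_sum; apply: eq_bigr => s _.
rewrite !mulr_sign.
have -> : \prod_i map_mx (fun f => in_vars f N) A i (s i) = in_vars (\prod_i A i (s i)) N.
  by rewrite in_vars_prod; apply: eq_bigr => i _; rewrite mxE.
by case: ifP => _ //; rewrite in_varsN.
Qed.

Lemma jt_delta N : jt (mdelta N) = 1.
Proof.
rewrite /jt -det_tr det_trig.
  by rewrite big1 // => i _; rewrite !mxE mnmE /hsub leqnn subnn sym_h10.
apply/is_trig_mxP => i j ij; rewrite !mxE mnmE /hsub leqNgt ltn_sub2lE ?ij //.
by rewrite -ltnS prednK // (leq_ltn_trans _ (ltn_ord j)).
Qed.

(** By [power_complete] every alternant is its Jacobi-Trudi determinant times a fixed [\det E]; the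
    case of [mdelta], where [jt] is 1, identifies [\det E]. *)
Lemma jt_alt N (m : 'X_{1..N}) :
  in_vars (jt m) N * alt K (mdelta N) = alt K m.
Proof.
pose E : 'M[{mpoly K[N]}]_N := \matrix_(k < N, j < N) jt_coef K j (N.-1 - k).
have F (m' : 'X_{1..N}) : alt K m' = in_vars (jt m') N * \det E.
  rewrite in_vars_det -det_mulmx /alt; congr (\det _); apply/matrixP => i j.
  rewrite !mxE power_complete; apply: eq_bigr => k _; rewrite !mxE /hsub.
  by case: ifP => _; rewrite ?in_vars_h1 ?in_vars0.
by rewrite !F jt_delta in_vars1 mul1r.
Qed.

Lemma jt_perm N (m : 'X_{1..N}) (s : 'S_N) : jt (m # s) = (-1) ^+ s * jt m.
Proof.
rewrite -det_perm -det_mulmx -row_permE; congr (\det _).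
by apply/matrixP => i j; rewrite !mxE mnmE.
Qed.

Lemma jt_repeat N (m : 'X_{1..N}) i j : i != j -> m i = m j -> jt m = 0.
Proof.
move=> ij mij; apply: (determinant_alternate ij) => k; by rewrite !mxE mij.
Qed.

Definition mpart N la : 'X_{1..N} := [multinom (nth 0 la i + (N.-1 - i))%N | i < N].

(** The new last row is (0, ..., 0, 1), and in the complementary minor both arguments of [hsub] are
    shifted by one. *)
Lemma jt_mpartS N la : (size la <= N)%N -> jt (mpart N.+1 la) = jt (mpart N la).
Proof.
move=> laN; rewrite /jt (expand_det_row _ ord_max) big_ord_recr /= big1 ?add0r; last first.
  move=> k _; rewrite !mxE mnmE nth_default //= subnn addn0 /hsub.
  by rewrite leqNgt subn_gt0 ltn_ord mul0r.
rewrite !mxE mnmE nth_default //= subnn /hsub leqnn subnn sym_h10 mul1r.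
rewrite /cofactor /= addnn -signr_odd odd_double mul1r; congr (\det _).
apply/matrixP => i k; rewrite !mxE !mnmE.
rewrite /= /bump !(leqNgt N) !ltn_ord !add0n.
have E (j : 'I_N) : (N - j = (N.-1 - j).+1)%N.
  have N0 : (0 < N)%N by exact: leq_ltn_trans (ltn_ord j).
  by rewrite -subSn ?prednK // -ltnS prednK.
by rewrite !E addnS /hsub ltnS subSS.
Qed.

(** [is_schur] concerns all large numbers of variables at once; by [jt_mpartS] one determinant
    serves them all. *)
Lemma is_schur_jt la N : (size la <= N)%N -> is_schur la (jt (mpart N la)).
Proof.
have S n : (size la <= n)%N -> jt (mpart n la) = jt (mpart (size la) la).
  move=> /subnK <-; elim: (n - _)%N => // k IH.
  by rewrite addSn jt_mpartS // leq_addl.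
move=> /S -> n lan; rewrite -(S n) // !alternantE.
exact: jt_alt.
Qed.

(** Each product in the determinant is zero or has degree at most [|m| - |delta|], whatever the
    permutation. *)
Lemma deg_le_jt N d (m : 'X_{1..N}) :
  (mdeg m <= d + mdeg (mdelta N))%N -> deg_le d (jt m).
Proof.
move=> md; rewrite /jt /determinant; apply: deg_le_sum => s _.
have [/forallP ge|] := boolP [forall i, (N.-1 - s i <= m i)%N]; last first.
  case/forallPn => i; rewrite -ltnNge => mi.
  rewrite [\prod_(i < N) _](bigD1 i) //= mxE /hsub leqNgt mi mul0r mulr0.
  exact: deg_le0.
have D : deg_le (\sum_(i < N) (m i - (N.-1 - s i))%N)
     (\prod_(i < N) (\matrix_(i < N, k < N) hsub (m i) (N.-1 - k)) i (s i)).
  apply: deg_le_prod => i; rewrite mxE /hsub ge; exact: deg_le_mono_sum.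
have {}D : deg_le d (\prod_(i < N) (\matrix_(i < N, k < N) hsub (m i) (N.-1 - k)) i (s i)).
  apply: deg_leW D; rewrite -(leq_add2r (mdeg (mdelta N))); apply: leq_trans md.
  rewrite !mdegE [X in (_ + X <= _)%N](reindex_inj (perm_inj (s := s))) /= -big_split /=.
  by apply: eq_leq; apply: eq_bigr => i _; rewrite mnmE subnK.
rewrite mulr_sign; case: ifP => _ //.
by rewrite -scaleN1r; apply: deg_leZ.
Qed.
End JacobiTrudi.

(** The zeros form a tail of [l], and 0 is also the default value of [nth]. *)
Lemma nth_filter_neq0 (l : seq nat) i : sorted geq l ->
  nth 0%N [seq x <- l | x != 0%N] i = nth 0%N l i.
Proof.
elim: l i => [|a l IH] i //= al.
have sl : sorted geq l by apply: path_sorted al.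
case: eqP => [a0|_] /=; last by case: i => [|i] //=; apply: IH.
have al0 : all (fun x => x == 0%N) l.
  have := order_path_min geq_trans al; rewrite a0; apply: sub_all => x /=.
  by rewrite leqn0.
have -> : [seq x <- l | x != 0%N] = [::].
  by apply/eqP; rewrite -[_ == _]negbK -has_filter; apply/hasPn => x /(allP al0) ->.
rewrite nth_nil; case: i => [|i] //=.
have [il|li] := ltnP i (size l); last by rewrite nth_default.
by have /eqP -> := allP al0 _ (mem_nth 0%N il).
Qed.

(** * Strictly decreasing exponent vectors and partitions *)

Section Sorting.
Variable N : nat.
Implicit Types m : 'X_{1..N}.

Definition decreasing m := forall i j : 'I_N, (i < j)%N -> (m j < m i)%N.

Lemma decreasing_sort m : injective m -> exists s : 'S_N, decreasing (m # s).
Proof.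
move=> mI.
have [s sE] : exists s : 'S_N, sort geq m = [tuple tnth m (s i) | i < N].
  by apply/tuple_permP; rewrite perm_sort.
exists s => i j ij.
have : sorted gtn (sort geq m).
  rewrite gtn_sorted_uniq_geq (sort_sorted geq_total) andbT sort_uniq.
  by rewrite mnm_map_enum map_inj_uniq ?enum_uniq.
move/(sorted_ltn_nth gtn_trans 0%N) => /(_ i j).
rewrite !inE size_sort size_tuple !ltn_ord => /(_ isT isT ij) /=.
rewrite sE -!tnth_nth !tnth_mktuple !mnmE !mnm_tnth; exact.
Qed.

(** Inverse of [mpart N] on decreasing vectors, where the truncated subtraction is exact by
    [decreasing_ge]. *)
Definition part_of m : seq nat :=
  [seq x <- [seq (m i - (N.-1 - i))%N | i <- enum 'I_N] | x != 0%N].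

Lemma size_part_of m : (size (part_of m) <= N)%N.
Proof.
rewrite size_filter; apply: leq_trans (count_size _ _) _.
by rewrite size_map size_enum_ord.
Qed.

(** The entry [m i] exceeds [N - 1 - i] distinct later entries; the induction runs from the last
    index upwards. *)
Lemma decreasing_ge m (i : 'I_N) : decreasing m -> (N.-1 - i <= m i)%N.
Proof.
move=> md.
have [k kE] : {k | k = (N.-1 - i)%N} by exists (N.-1 - i)%N.
rewrite -kE; elim: k i kE => // k IH i kE.
have iN : (i.+1 < N)%N.
  have : (0 < N.-1 - i)%N by rewrite -kE.
  by rewrite subn_gt0 -ltnS prednK // (leq_ltn_trans _ (ltn_ord i)).
apply: leq_ltn_trans (IH (Ordinal iN) _) (md i (Ordinal iN) (ltnSn _)).
by rewrite /= subnS -kE.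
Qed.

Lemma part_of_sorted m : decreasing m ->
  sorted geq [seq (m i - (N.-1 - i))%N | i <- enum 'I_N].
Proof.
move=> md; apply/(sortedP 0%N) => i; rewrite size_map size_enum_ord => iN.
have iN' := ltnW iN.
rewrite !(nth_map (Ordinal iN)) -?enumT ?size_enum_ord //.
have -> : nth (Ordinal iN) (enum 'I_N) i = Ordinal iN'.
  by apply: val_inj; rewrite /= nth_enum_ord.
have -> : nth (Ordinal iN) (enum 'I_N) i.+1 = Ordinal iN.
  by apply: val_inj; rewrite /= nth_enum_ord.
have := md (Ordinal iN') (Ordinal iN) (ltnSn _).
have := decreasing_ge (Ordinal iN') md; rewrite /= subnS.
have : (0 < N.-1 - i)%N by rewrite subn_gt0 -ltnS prednK // (leq_ltn_trans _ iN).
case: (N.-1 - i)%N => // k _ /=; move=> km mm.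
by rewrite subnS -ltnS prednK ?subn_gt0 // ltn_sub2r.
Qed.

Lemma part_of_partition m : decreasing m -> is_partition (part_of m).
Proof.
move=> md; apply/andP; split; last by rewrite mem_filter.
exact: (sorted_filter geq_trans _ (part_of_sorted md)).
Qed.

Lemma mpart_part_of m : decreasing m -> mpart N (part_of m) = m.
Proof.
move=> md; apply/mnmP => i; rewrite mnmE nth_filter_neq0 ?part_of_sorted //.
rewrite (nth_map i) ?size_enum_ord // nth_ord_enum subnK //; exact: decreasing_ge.
Qed.

Lemma decreasing_uniq m (s : 'S_N) : decreasing m -> decreasing (m # s) -> m # s = m.
Proof.
have so m' : decreasing m' -> sorted gtn m'.
  move=> md; apply/(sortedP 0%N) => i; rewrite size_tuple => iN.
  have iN' := ltnW iN.
  have := md (Ordinal iN') (Ordinal iN) (ltnSn _).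
  by rewrite !(mnm_nth 0%N).
move=> /so m1 /so m2; apply/val_inj/val_inj.
apply: (sorted_eq gtn_trans) m2 m1 _.
  by move=> x y /= /andP[xy yx]; have := ltn_trans xy yx; rewrite ltnn.
by apply/tuple_permP; exists s.
Qed.
End Sorting.

(** * The Hall product on power sums *)

Section Hall.
Variable K : numFieldType.
Variable hall : {biscalar symfun K}.
Hypothesis hallP : is_hall hall.
Implicit Types (f g : symfun K) (N : nat).

Lemma hall_sumZl I (r : seq I) (c : I -> K) (F : I -> symfun K) g :
  hall (\sum_(i <- r) c i *: F i) g = \sum_(i <- r) c i * hall (F i) g.
Proof.
by rewrite linear_sumlz; apply: eq_bigr => i _; rewrite linearZl_LR.
Qed.

Lemma hall_sumZr I (r : seq I) (c : I -> K) (F : I -> symfun K) g :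
  hall g (\sum_(i <- r) c i *: F i) = \sum_(i <- r) c i * hall g (F i).
Proof.
by rewrite linear_sumr; apply: eq_bigr => i _; rewrite linearZr_LR.
Qed.

Lemma jt_eq0 N (m : 'X_{1..N}) : ~~ injectiveb m -> jt K m = 0.
Proof. by case/injectivePn => i [j ij mij]; exact: jt_repeat ij mij. Qed.

Lemma hall_jt_decreasing N (m m' : 'X_{1..N}) : decreasing m -> decreasing m' ->
  hall (jt K m) (jt K m') = (m == m')%:R.
Proof.
move=> md md'.
rewrite -[in jt K m](mpart_part_of md) -[in jt K m'](mpart_part_of md').
rewrite (hallP (part_of_partition md) (part_of_partition md')); last 2 first.
- exact: is_schur_jt (size_part_of _).
- exact: is_schur_jt (size_part_of _).
congr (_%:R); congr nat_of_bool.
apply/eqP/eqP => [e|-> //]; by rewrite -(mpart_part_of md) e mpart_part_of.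
Qed.

Lemma decreasing_inj N (m : 'X_{1..N}) : decreasing m -> injective m.
Proof.
move=> md i j mij; apply: val_inj.
by case: (ltngtP i j) => [/md|/md|//]; rewrite mij ltnn.
Qed.

Lemma alt_perm N (m : 'X_{1..N}) (s : 'S_N) : alt K (m # s) = (-1) ^+ s *: alt K m.
Proof.
rewrite -(jt_alt K (m # s)) -(jt_alt K m) jt_perm scalerAl -in_varsZ.
congr (in_vars _ N * _); by rewrite mulr_sign scaler_sign.
Qed.

Lemma mcoeff_alt_decreasing N (m m' : 'X_{1..N}) : decreasing m -> decreasing m' ->
  (alt K m)@_m' = (m == m')%:R.
Proof.
move=> md md'; have [<-|mm] := eqVneq m m'.
  by rewrite alt_inj //; apply: decreasing_inj.
rewrite mcoeff_alt big1 // => s _; case: eqP => // e.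
by rewrite -e decreasing_uniq ?e ?eqxx // in mm.
Qed.

(** Both sides are alternating in [m] and in [m']: they vanish on repeated exponents, and otherwise
    both vectors can be sorted, which reduces to the orthonormality of Schur functions. *)
Lemma hall_jt N (m m' : 'X_{1..N}) : hall (jt K m) (jt K m') = (alt K m)@_m'.
Proof.
have [mI|mI] := boolP (injectiveb m); last first.
  by rewrite jt_eq0 // linear0l -(jt_alt K) jt_eq0 // in_vars0 mul0r mcoeff0.
have [mI'|mI'] := boolP (injectiveb m'); last first.
  rewrite (jt_eq0 mI') linear0r; apply/esym/eqP; apply: contraNT mI' => nz.
  by apply/injectiveP/(antisym_inj (@antisym_alt K N m) nz).
have [s sd] := decreasing_sort (injectiveP _ mI).
have [s' sd'] := decreasing_sort (injectiveP _ mI').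
have := hall_jt_decreasing sd sd'; rewrite -mcoeff_alt_decreasing //.
rewrite !jt_perm alt_perm mcoeffZ antisym_mcoeff; last exact: antisym_alt.
have signE (t : 'S_N) f : (-1) ^+ t * f = (-1) ^+ t *: f by rewrite mulr_sign scaler_sign.
rewrite !signE linearZl_LR linearZr_LR /=.
have sg0 (t : 'S_N) : (-1) ^+ t != 0 :> K by rewrite signr_eq0.
by move=> /(mulfI (sg0 _))/(mulfI (sg0 _)).
Qed.

End Hall.

(** * The adjoint of multiplication by a power sum *)

Section Shift.
Variables (K : numFieldType) (N : nat).
Implicit Types (P Q : {mpoly K[N]}) (m : 'X_{1..N}) (k l V : nat).

Definition psum k : {mpoly K[N]} := \sum_i 'X_i ^+ k.

Lemma mcoeff_psumM k P m :
  (psum k * P)@_m = \sum_i (if (k <= m i)%N then P@_(m - U_(i) *+ k) else 0).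
Proof.
by rewrite mulr_suml raddf_sum /=; apply: eq_bigr => i _; rewrite mcoeffMXn.
Qed.

Lemma psum_sym k : psum k \is symmetric.
Proof.
apply/issymP => s; apply/mpolyP => m; rewrite mcoeff_sym !raddf_sum /=.
rewrite [RHS](reindex_inj (perm_inj (s := s))) /=; apply: eq_bigr => i _.
rewrite !mpolyXn !mcoeffX; congr (_%:R); congr nat_of_bool.
apply/eqP/eqP => [/mnmP e|<-]; apply/mnmP => j.
  have := e ((s^-1)%g j); rewrite !mulmnE !mnmE permKV => <-.
  by rewrite -[i == _](inj_eq (perm_inj (s := s))) permKV.
by rewrite !mnmE !mulmnE !mnm1E (inj_eq perm_inj).
Qed.

(* Coefficientwise, the adjoint of multiplication by [psum k] for the bilinear form
   making the monomials orthonormal. *)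
Definition shift k P m : K := \sum_i P@_(m + U_(i) *+ k).

(* This holds for [alt mdelta] with [V = N]; multiplication by [psum l] lowers [V] by at
   most [l]. *)
Definition full V P := forall m v, P@_m != 0 -> (v < V)%N -> exists i, m i = v.

Lemma full_alt_mdelta : full N (alt K (mdelta N)).
Proof.
move=> m v /mcoeff_alt_neq0[s sm] vN.
have wN : (N.-1 - v < N)%N.
  by rewrite (leq_ltn_trans (leq_subr _ _)) // prednK // (leq_ltn_trans _ vN).
exists ((s^-1)%g (Ordinal wN)); rewrite -sm !mnmE permKV /= subKn //.
by rewrite -ltnS prednK // (leq_ltn_trans _ vN).
Qed.

Lemma fullW V V' P : (V' <= V)%N -> full V P -> full V' P.
Proof. by move=> VV fP m v nz vV; apply: fP nz (leq_trans vV VV). Qed.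

Lemma antisym_psumM k P : antisym P -> antisym (psum k * P).
Proof. exact/antisymM/psum_sym. Qed.

(** Some [m - l U_i] has a nonzero coefficient in [P]. If it takes the value [v] only at [i], then
    [m i = v + l], a value that it must also take at some [j] other than [i]; so [m j = m i], which
    antisymmetry forbids. *)
Lemma full_psumM V l P : (0 < l)%N -> antisym P -> full (V + l) P -> full V (psum l * P).
Proof.
move=> l0 aP fP m v nz vV.
have mI := antisym_inj (antisym_psumM l aP) nz.
have [i] : exists i, (if (l <= m i)%N then P@_(m - U_(i) *+ l) else 0) != 0.
  apply/existsP; apply: contraNT nz => /existsPn z.
  by rewrite mcoeff_psumM big1 // => i _; apply/eqP; have := z i; rewrite negbK.
case: leqP => [li nzi|_]; last by rewrite eqxx.
have mE j : (m - U_(i) *+ l)%MM j = if j == i then (m j - l)%N else m j.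
  by rewrite mnmBE mulmnE mnm1E eq_sym; case: eqP; rewrite ?mul1n ?mul0n ?subn0.
have [j] := fP _ v nzi (leq_trans vV (leq_addr _ _)).
rewrite mE; case: (eqVneq j i) => [->{j}|ji <-]; last by exists j.
move=> miv; have vl : (v + l < V + l)%N by rewrite ltn_add2r.
have [j] := fP _ _ nzi vl; rewrite mE; case: (eqVneq j i) => [->|ji mj].
  by rewrite miv => /eqP; rewrite -[X in X == _]addn0 eqn_add2l eq_sym -leqn0 leqNgt l0.
by case/eqP: ji; apply: mI; rewrite mj -miv subnK.
Qed.

(** Every value below [k] is an exponent of [m] by fullness, and only once by antisymmetry. *)
Lemma card_lt_full V P m k : antisym P -> full V P -> (k <= V)%N -> P@_m != 0 ->
  (\sum_i (m i < k) = k)%N.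
Proof.
move=> aP fP kV nz; have mI := antisym_inj aP nz.
transitivity (\sum_(v < k) 1)%N; last by rewrite sum1_card card_ord.
transitivity (\sum_i \sum_(v < k) (m i == v))%N.
  apply: eq_bigr => i _; case: ltnP => [mk|km].
    rewrite (bigD1 (Ordinal mk)) //= eqxx big1 // => v /eqP vm.
    by case: eqP => // e; case: vm; apply: val_inj.
  rewrite big1 // => v _; case: eqP => // e.
  by have := ltn_ord v; rewrite -e ltnNge km.
rewrite exchange_big; apply: eq_bigr => v _.
have [i mi] := fP _ v nz (leq_trans (ltn_ord v) kV).
rewrite (bigD1 i) //= mi eqxx big1 // => j ji; case: eqP => // mj.
by case/eqP: ji; apply: mI; rewrite mi mj.
Qed.

(* The sum is alternating as a function of [m]. *)
Lemma shift_repeat (c : pred nat) k l P m i j : antisym P -> i != j -> m i = m j ->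
  \sum_p (if c (m p) then P@_(m + U_(p) *+ k - U_(p) *+ l) else 0) = 0.
Proof.
move=> aP ij mij; pose t := tperm i j.
pose D p := if c (m p) then P@_(m + U_(p) *+ k - U_(p) *+ l) else 0.
have tm : m # t = m by apply/mnmP => p; rewrite mnmE; case: tpermP => // ->.
have Dt p : D (t p) = - D p.
  rewrite /D.
  have -> : m (t p) = m p by rewrite -[in RHS]tm mnmE.
  case: ifP => _; last by rewrite oppr0.
  have -> : (m + U_(t p) *+ k - U_(t p) *+ l)%MM = (m + U_(p) *+ k - U_(p) *+ l)%MM # t.
    apply/mnmP => q; rewrite !(mnmDE, mnmBE, mnmE) !mulmnE !mnm1E.
    have -> : m (t q) = m q by rewrite -[in RHS]tm mnmE.
    by rewrite -[p == _](inj_eq (perm_inj (s := t))) tpermK.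
  by rewrite antisym_mcoeff // odd_tperm ij mulN1r.
apply/eqP; rewrite -[_ == 0](mulrn_eq0 _ 2) mulr2n addr_eq0 -sumrN.
by rewrite [X in X == _](reindex_inj (perm_inj (s := t))) (eq_bigr _ (fun p _ => Dt p)).
Qed.

(* The commutator of the adjoint of [p_k] with [p_l]: raising the exponent [m i] by [k] and
   lowering it by [l] do not commute exactly when [m i < l <= m i + k].  For [k = l] this
   happens for [k] indices [i]; for [k <> l] every such term forces [m] to have a repeated
   exponent, and then the whole sum vanishes. *)
Lemma shift_psumM V k l P m : (0 < k)%N -> (0 < l)%N -> (k <= V)%N -> (l <= V)%N ->
  antisym P -> full V P ->
  shift k (psum l * P) m =
  \sum_j (if (l <= m j)%N then shift k P (m - U_(j) *+ l) else 0)
  + P@_m *+ ((k == l) * k).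
Proof.
move=> k0 l0 kV lV aP fP.
pose D i := if (m i < l <= m i + k)%N then P@_(m + U_(i) *+ k - U_(i) *+ l) else 0.
transitivity (\sum_j (if (l <= m j)%N then shift k P (m - U_(j) *+ l) else 0) + \sum_i D i).
  rewrite /shift; under eq_bigr => i _ do rewrite mcoeff_psumM.
  have -> : \sum_j (if (l <= m j)%N then \sum_i P@_(m - U_(j) *+ l + U_(i) *+ k) else 0)
    = \sum_i \sum_j (if (l <= m j)%N then P@_(m - U_(j) *+ l + U_(i) *+ k) else 0).
    rewrite exchange_big; apply: eq_bigr => j _; case: ifP => // _.
    by rewrite big1.
  rewrite -big_split; apply: eq_bigr => i _ /=.
  (* Raising at [i] and lowering at [j] commute for [j] other than [i]; [D i] is the defect of the
     diagonal term. *)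
  rewrite (bigD1 i) //= [in RHS](bigD1 i) //= addrAC; congr (_ + _).
    rewrite /D mnmDE mulmnE mnm1E eqxx mul1n.
    case: (leqP l (m i)) => [lm|ml] /=; last by rewrite add0r.
    rewrite (leq_trans lm (leq_addr _ _)) addr0; congr (P@__).
    apply/mnmP => j; rewrite !(mnmDE, mnmBE) !mulmnE !mnm1E.
    by have [<-|_] := eqVneq i j; rewrite ?mul0n ?addn0 ?subn0 // !mul1n addnBAC.
  apply: eq_bigr => j ji; rewrite mnmDE mulmnE mnm1E eq_sym (negbTE ji) mul0n addn0.
  case: ifP => // lm; congr (P@__); apply/mnmP => p.
  rewrite !(mnmDE, mnmBE) !mulmnE !mnm1E.
  have [jp|_] := eqVneq j p; last by rewrite mul0n !subn0.
  by rewrite -jp eq_sym (negbTE ji) mul0n !addn0.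
congr (_ + _); have [kl|kl] := eqVneq k l.
  have DE i : D i = P@_m *+ (m i < k)%N.
    rewrite /D -kl leq_addl andbT; case: ifP => // _; rewrite mulr1n; congr (P@__).
    by apply/mnmP => j; rewrite !(mnmDE, mnmBE) addnK.
  under eq_bigr => i _ do rewrite DE.
  rewrite sumrMnr mul1n.
  have [->|nz] := eqVneq P@_m 0; first by rewrite !mul0rn.
  by rewrite (card_lt_full aP fP kV nz).
rewrite mul0n mulr0n.
have [/existsP[i]|] := boolP [exists i, D i != 0]; last first.
  by move=> /existsPn z; rewrite big1 // => i _; apply/eqP; have := z i; rewrite negbK.
rewrite {1}/D; case: ifP => [/andP[ml lmk] nz|_]; last by rewrite eqxx.
(* As [m i < l <= V], fullness provides a place [j] where the modified vector takes the value [m i];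
   it is not [i], since [k] and [l] differ. *)
have [j mj] := fP _ _ nz (leq_trans ml lV).
have ji : j != i.
  apply/eqP => ji; move: mj; rewrite ji !(mnmDE, mnmBE) !mulmnE !mnm1E eqxx !mul1n => e.
  have /addnI/eqP : (m i + k = m i + l)%N by rewrite -[in RHS]e subnK.
  by rewrite (negbTE kl).
have {}mj : m j = m i.
  by move: mj; rewrite !(mnmDE, mnmBE) !mulmnE !mnm1E eq_sym (negbTE ji) !mul0n addn0 subn0.
exact: (@shift_repeat (fun v => v < l <= v + k)%N k l P m j i).
Qed.

Definition ppsum (la : seq nat) : {mpoly K[N]} :=
  (\prod_(l <- la) psum l) * alt K (mdelta N).

Lemma ppsum_cons l la : ppsum (l :: la) = psum l * ppsum la.
Proof. by rewrite /ppsum big_cons mulrA. Qed.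

Lemma antisym_ppsum la : antisym (ppsum la).
Proof.
elim: la => [|l la IH]; last by rewrite ppsum_cons; apply: antisym_psumM.
by rewrite /ppsum big_nil mul1r; apply: antisym_alt.
Qed.

Lemma full_ppsum V la : 0%N \notin la -> (V + sumn la <= N)%N -> full V (ppsum la).
Proof.
elim: la V => [|l la IH] V.
  by rewrite addn0 /ppsum big_nil mul1r => _ VN; apply: fullW VN full_alt_mdelta.
rewrite inE negb_or eq_sym -lt0n => /andP[l0 la0] /=; rewrite addnA => VN.
by rewrite ppsum_cons; apply: full_psumM => //; [apply: antisym_ppsum|apply: IH].
Qed.

(** On products of power sums times [a_delta], [shift k] acts as [k] times the derivative in [p_k]:
    it passes through each factor by [shift_psumM], with an extra term when the factor is [p_k], and
    it kills [a_delta]. *)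
Lemma shift_ppsum k la m : (0 < k)%N -> 0%N \notin la -> (k + sumn la <= N)%N ->
  shift k (ppsum la) m = (ppsum (rem k la))@_m *+ (k * count_mem k la).
Proof.
move=> k0; elim: la m => [|l la IH] m.
  move=> _ _; rewrite muln0 mulr0n /ppsum big_nil mul1r.
  have aP := @antisym_alt K N (mdelta N).
  have [/existsP[i nz]|/existsPn z] :=
      boolP [exists i, (alt K (mdelta N))@_(m + U_(i) *+ k) != 0]; last first.
    by rewrite /shift big1 // => i _; apply/eqP; have := z i; rewrite negbK.
  (* A nonzero term makes [m + k U_i] a rearrangement of [mdelta]. It takes the value [m i] at some
     [j] other than [i], so [m] has a repeated exponent and the whole sum vanishes. *)
  have miN : (m i < N)%N.
    have [s sm] := mcoeff_alt_neq0 nz.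
    have := congr1 (fun m => fun_of_multinom m i) sm.
    rewrite !mnmE => e; apply: (@leq_ltn_trans (N.-1 - s i)).
      by rewrite e leq_addr.
    by rewrite (leq_ltn_trans (leq_subr _ _)) // prednK // (leq_ltn_trans _ (ltn_ord i)).
  have [j] := full_alt_mdelta nz miN.
  rewrite mnmDE mulmnE mnm1E; have [<-|ij] := eqVneq i j.
    by move/eqP; rewrite mul1n -[X in _ == X]addn0 eqn_add2l eqn0Ngt k0.
  rewrite mul0n addn0 => mji; rewrite -[RHS](@shift_repeat xpredT k 0 _ m i j aP ij (esym mji)).
  by apply: eq_bigr => p _; rewrite mulm0n subm0.
rewrite inE negb_or eq_sym -lt0n => /andP[l0 la0] /= kN.
have kN' : (k + sumn la <= N)%N by apply: leq_trans kN; rewrite leq_add2l leq_addl.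
have lkV : (maxn k l + sumn la <= N)%N.
  by apply: leq_trans kN; rewrite addnA leq_add2r geq_max leq_addr leq_addl.
rewrite ppsum_cons (shift_psumM m k0 l0 (leq_maxl k l) (leq_maxr k l) (antisym_ppsum la)
  (full_ppsum la0 lkV)).
under eq_bigr => j _ do rewrite IH //.
have -> : \sum_j (if (l <= m j)%N
      then (ppsum (rem k la))@_(m - U_(j) *+ l) *+ (k * count_mem k la) else 0)
   = (ppsum (l :: rem k la))@_m *+ (k * count_mem k la).
  rewrite ppsum_cons mcoeff_psumM -sumrMnl; apply: eq_bigr => j _.
  by case: ifP; rewrite ?mul0rn.
rewrite [k == l]eq_sym; have [->|_] := eqVneq l k; last by rewrite mul0n addr0 add0n.
rewrite !mul1n mulnDr muln1 mulrnDr addrC; congr (_ + _).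
have [kla|/count_memPn ->] := boolP (k \in la); last by rewrite muln0 !mulr0n.
congr (_@__ *+ _); rewrite /ppsum; congr (_ * _).
by apply: perm_big; rewrite perm_sym perm_to_rem.
Qed.
End Shift.

Lemma sum_mul_count n (la : seq nat) : all (fun x => 0 < x <= n)%N la ->
  (\sum_(i < n) i.+1 * count_mem i.+1 la)%N = sumn la.
Proof.
elim: la => [|k la IH] /=; first by rewrite big1 // => i _; rewrite muln0.
case/andP=> /andP[k0 kn] /IH <-.
under eq_bigr => i _ do rewrite mulnDr.
rewrite big_split /=; congr addn.
have kn' : (k.-1 < n)%N by rewrite prednK.
rewrite (bigD1 (Ordinal kn')) //= prednK // eqxx muln1 big1 ?addn0 // => i ik.
case: eqP => [e|_]; last by rewrite muln0.
by case/eqP: ik; apply: val_inj; rewrite /= e.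
Qed.

(** * Pairings of power sums and complete functions *)

Section HallPower.
Variable K : numFieldType.
Variable hall : {biscalar symfun K}.
Hypothesis hallP : is_hall hall.
Implicit Types (f g : symfun K) (N : nat) (la mu : seq nat).

(** Multiplication by the Vandermonde alternant, not a signed average over permutations. *)
Definition antisymmetrize N f : {mpoly K[N]} := in_vars f N * alt K (mdelta N).

Lemma antisym_antisymmetrize N f : antisym (antisymmetrize N f).
Proof.
apply: antisymM; last exact: antisym_alt.
by apply/issymP => s; apply: in_vars_sym.
Qed.

(** The Schur expansion of [f]: expand [f a_delta] in alternants, divide by [a_delta] using
    [jt_alt], and lift the identity from [N] variables since [N] bounds the degrees. *)
Lemma antisymmetrize_jt N f : deg_le N f ->
  N`!%:R *: f = \sum_(m <- msupp (antisymmetrize N f)) (antisymmetrize N f)@_m *: jt K m.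
Proof.
move=> fN; set P := antisymmetrize N f.
have Pd m : m \in msupp P -> (mdeg m <= N + mdeg (mdelta N))%N.
  move=> /msuppM_le/allpairsP[[m1 m2] /= [m1f m2a ->]].
  rewrite mdegD leq_add //; first by rewrite -ltnS (leq_trans (msize_mdeg_lt m1f)).
  by move: m2a; rewrite mcoeff_msupp => /mcoeff_alt_neq0[s <-]; rewrite mdeg_mperm.
apply: (@deg_le_eq _ N N) => //; first exact: deg_leZ.
  rewrite big_seq_cond; apply: deg_le_sum => m; rewrite andbT => mP.
  by apply/deg_leZ/deg_le_jt/Pd.
apply: (mulIf (alt_mdelta_neq0 K N)).
rewrite in_varsZ -scalerAl -/(antisymmetrize N f) antisym_expand; last first.
  exact: antisym_antisymmetrize.
rewrite in_vars_sum mulr_suml; apply: eq_bigr => m _.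
by rewrite in_varsZ -scalerAl jt_alt.
Qed.

(** Expanding both arguments costs [N!] twice; by [hall_jt] the inner sum is again that of
    [antisym_expand], which gives one factor back. *)
Lemma hallE N f g : deg_le N f -> deg_le N g ->
  N`!%:R * hall f g = \sum_(m <- msupp (antisymmetrize N g))
     (antisymmetrize N g)@_m * (antisymmetrize N f)@_m.
Proof.
move=> fN gN; have N0 : N`!%:R != 0 :> K by rewrite pnatr_eq0 -lt0n fact_gt0.
have Zl a f' g' : hall (a *: f') g' = a * hall f' g' by rewrite linearZl_LR.
have Zr a f' g' : hall f' (a *: g') = a * hall f' g' by rewrite linearZr_LR.
apply: (mulfI N0); rewrite -Zl -Zr.
rewrite !antisymmetrize_jt // hall_sumZr mulr_sumr.
apply: eq_bigr => m _; rewrite hall_sumZl [RHS]mulrCA; congr (_ * _).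
under eq_bigr => m' _ do rewrite hall_jt // -mcoeffZ.
rewrite -(raddf_sum (mcoeff m)) /= -antisym_expand ?mcoeffZ //.
exact: antisym_antisymmetrize.
Qed.

Lemma in_vars_p la N : 0%N \notin la ->
  in_vars (sym_p K la) N = \prod_(l <- la) psum K N l.
Proof.
move=> la0; rewrite /sym_p in_vars_prod !big_seq; apply: eq_bigr => l lla.
by rewrite in_vars_p1 //; apply: contraNneq la0 => <-.
Qed.

Lemma antisymmetrize_p la N : 0%N \notin la ->
  antisymmetrize N (sym_p K la) = ppsum K N la.
Proof. by move=> la0; rewrite /antisymmetrize in_vars_p. Qed.

Lemma deg_le_p1 k : deg_le k (sym_p1 K k).
Proof. by apply: deg_leW (deg_le_mono_sum _ _); rewrite /= addn0. Qed.

Lemma deg_le_p la : deg_le (sumn la) (sym_p K la).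
Proof.
rewrite sumnE; apply: deg_le_prod => k; exact: deg_le_p1.
Qed.

(** Adjointness, by the substitution of [m + k U_i] for [m]. The degrees below [D] cover the support
    of [shift k Q]. *)
Lemma pairing_shift N D (P Q : {mpoly K[N]}) k : (msize Q <= D)%N ->
  \sum_(m <- msupp Q) Q@_m * (psum K N k * P)@_m
  = \sum_(m : 'X_{1..N < D}) shift k Q m * P@_m.
Proof.
move=> QD; rewrite /shift.
under eq_bigr => m _ do rewrite mcoeff_psumM mulr_sumr.
rewrite exchange_big; under [RHS]eq_bigr => m _ do rewrite mulr_suml.
rewrite [RHS]exchange_big; apply: eq_bigr => i _ /=.
under [RHS]eq_bigr => m _ do rewrite -mcoeff_msupp_sum mulr_suml.
rewrite [RHS]exchange_big !big_seq; apply: eq_bigr => q qQ /=.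
have qD : (mdeg q < D)%N by apply: leq_trans (msize_mdeg_lt qQ) QD.
case: leqP => [kq|qk].
  have q'D : (mdeg (q - U_(i) *+ k) < D)%N by apply: leq_ltn_trans (mdegB _ _) qD.
  rewrite (bigD1 (BMultinom q'D)) //= (submMnK kq) eqxx mulr1n big1 ?addr0 // => m mq.
  case: eqP => [e|_]; last by rewrite mulr0n mul0r.
  by case/eqP: mq; apply/val_inj; rewrite /= e addmK.
rewrite mulr0 big1 // => m _; case: eqP => [e|_]; last by rewrite mulr0n mul0r.
by move: qk; rewrite e mnmDE mulmnE mnm1E eqxx mul1n ltnNge leq_addl.
Qed.

Lemma msupp_sumE N D (P Q : {mpoly K[N]}) : (msize Q <= D)%N ->
  \sum_(m <- msupp Q) Q@_m * P@_m = \sum_(m : 'X_{1..N < D}) Q@_m * P@_m.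
Proof.
move=> QD; under [RHS]eq_bigr => m _ do rewrite -mcoeff_msupp_sum mulr_suml.
rewrite [RHS]exchange_big !big_seq; apply: eq_bigr => q qQ /=.
have qD : (mdeg q < D)%N by apply: leq_trans (msize_mdeg_lt qQ) QD.
rewrite (bigD1 (BMultinom qD)) //= eqxx mulr1n big1 ?addr0 // => m mq.
by case: eqP => [e|_]; [case/eqP: mq; apply/val_inj|rewrite mulr0n mul0r].
Qed.

(** The two arguments play the same role in the formula of [hallE]. *)
Lemma hallC f g : hall f g = hall g f.
Proof.
have [d fd] := deg_le_exists f; have [e ge] := deg_le_exists g.
have fN := deg_leW (leq_addr e d) fd; have gN := deg_leW (leq_addl d e) ge.
have N0 : (d + e)`!%:R != 0 :> K by rewrite pnatr_eq0 -lt0n fact_gt0.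
apply: (mulfI N0); rewrite !hallE //.
set P := antisymmetrize _ f; set Q := antisymmetrize _ g.
pose D := maxn (msize P) (msize Q).
rewrite (msupp_sumE (D := D)) ?leq_maxr // (msupp_sumE (D := D)) ?leq_maxl //.
by apply: eq_bigr => m _; rewrite mulrC.
Qed.

(** [pairing_shift] moves [p_k] to the other argument, where [shift_ppsum] computes its adjoint. The
    choice of [N] bounds all degrees and meets the condition of [shift_ppsum]. *)
Lemma hall_p1M f k la : (0 < k)%N -> 0%N \notin la ->
  hall (sym_p1 K k * f) (sym_p K la) = hall f (sym_p K (rem k la)) *+ (k * count_mem k la).
Proof.
move=> k0 la0; have [d fd] := deg_le_exists f.
pose N := (d + (k + sumn la))%N.
have N0 : N`!%:R != 0 :> K by rewrite pnatr_eq0 -lt0n fact_gt0.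
have rla0 : 0%N \notin rem k la by apply: contra la0 => /mem_rem.
have rN : (sumn (rem k la) <= sumn la)%N.
  have [kla|kla] := boolP (k \in la); last by rewrite rem_id.
  by rewrite !sumnE [X in (_ <= X)%N](perm_big _ (perm_to_rem kla)) big_cons leq_addl.
have f1 : deg_le N (sym_p1 K k * f).
  have := deg_leM (deg_le_p1 k) fd.
  by apply: deg_leW; rewrite /N addnC leq_add2l leq_addr.
have f2 : deg_le N f by apply: deg_leW fd; apply: leq_addr.
have f3 : deg_le N (sym_p K la).
  by apply: deg_leW (deg_le_p la); rewrite /N addnA leq_addl.
have f4 : deg_le N (sym_p K (rem k la)).
  by apply: deg_leW (deg_le_p _); rewrite /N addnA (leq_trans rN) // leq_addl.
apply: (mulfI N0); rewrite mulrnAr !hallE //.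
rewrite !antisymmetrize_p //.
pose D := maxn (msize (ppsum K N la)) (msize (ppsum K N (rem k la))).
have -> : antisymmetrize N (sym_p1 K k * f) = psum K N k * antisymmetrize N f.
  by rewrite /antisymmetrize in_varsM in_vars_p1 ?mulrA // -lt0n.
rewrite (pairing_shift (D := D)) ?leq_maxl // (msupp_sumE (D := D)) ?leq_maxr //.
rewrite -sumrMnl; apply: eq_bigr => m _; rewrite -mulrnAl shift_ppsum //.
exact: leq_addl.
Qed.

Lemma hall_p_orth la mu : 0%N \notin la -> 0%N \notin mu -> ~~ perm_eq la mu ->
  hall (sym_p K la) (sym_p K mu) = 0.
Proof.
elim: la mu => [|k la IH] mu.
  case: mu => [|k mu] // _; rewrite inE negb_or eq_sym -lt0n => /andP[k0 mu0] _.
  have pE : sym_p K (k :: mu) = sym_p1 K k * sym_p K mu by rewrite /sym_p big_cons.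
  by rewrite hallC pE hall_p1M // muln0 mulr0n.
rewrite inE negb_or eq_sym -lt0n => /andP[k0 la0] mu0 pe.
have -> : sym_p K (k :: la) = sym_p1 K k * sym_p K la by rewrite /sym_p big_cons.
rewrite hall_p1M //; have [kmu|/count_memPn ->] := boolP (k \in mu); last first.
  by rewrite muln0 mulr0n.
rewrite IH ?mul0rn //; first by apply: contra mu0 => /mem_rem.
by apply: contra pe => pe; rewrite perm_sym (permPl (perm_to_rem kmu)) perm_cons perm_sym.
Qed.

(** By [newton_h], [hall_p1M] and induction, [n] times the pairing is the sum of [i m_i(la)] over
    [i], that is [n]. The base case is the norm of the Schur function 1. *)
Lemma hall_h_p n la : 0%N \notin la -> sumn la = n ->
  hall (sym_h1 K n) (sym_p K la) = 1.
Proof.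
elim/ltn_ind: n la => -[|n] IH la la0 lan.
  have la_nil : la = [::].
    case: la la0 lan => // k la; rewrite inE negb_or eq_sym /= => /andP[k0 _] /eqP.
    by rewrite addn_eq0 (negbTE k0).
  rewrite la_nil sym_h10 /sym_p big_nil.
  have s1 : is_schur [::] (1 : symfun K).
    move=> N _; rewrite in_vars1 mul1r; congr (\det _).
    by apply/matrixP => i j; rewrite !mxE nth_nil.
  by rewrite (hallP _ _ s1 s1).
have n0 : n.+1%:R != 0 :> K by rewrite pnatr_eq0.
apply: (mulfI n0); rewrite mulr1.
have -> : n.+1%:R * hall (sym_h1 K n.+1) (sym_p K la) = hall (sym_h1 K n.+1 *+ n.+1) (sym_p K la).
  by rewrite linearMnl mulr_natl.
rewrite newton_h linear_sumlz.
rewrite (eq_bigr (fun i : 'I_n.+1 => (i.+1 * count_mem i.+1 la)%:R)); last first.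
  move=> i _; rewrite hall_p1M //.
  have [ila|/count_memPn ->] := boolP (i.+1 \in la); last by rewrite muln0 mulr0n.
  rewrite IH //; first by rewrite ltnS leq_subr.
    by apply: contra la0 => /mem_rem.
  have := lan; rewrite !sumnE (perm_big _ (perm_to_rem ila)) big_cons => e.
  by apply/eqP; rewrite -(eqn_add2l i.+1) e addSn subnKC // -ltnS.
rewrite -natr_sum -[in RHS]lan sum_mul_count //.
apply/allP => x xla; apply/andP; split.
  by rewrite lt0n; apply: contraNneq la0 => <-.
by rewrite -lan sumnE (perm_big _ (perm_to_rem xla)) big_cons leq_addr.
Qed.

End HallPower.

(** * Colourings and extensions of partial permutations *)

Lemma big_tuple_cons (R : Type) (idx : R) (op : Monoid.com_law idx) (S : finType) l
    (F : l.+1.-tuple S -> R) :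
  \big[op/idx]_(c : l.+1.-tuple S) F c
  = \big[op/idx]_(a : S) \big[op/idx]_(c : l.-tuple S) F [tuple of a :: c].
Proof.
rewrite pair_big (reindex (fun p : S * l.-tuple S => [tuple of p.1 :: p.2])) //=.
exists (fun c : l.+1.-tuple S => (thead c, [tuple of behead c])) => [[a c] _|c _] /=.
  by congr pair; apply/val_inj.
by rewrite [RHS]tuple_eta.
Qed.

Section Colorings.
Variables (K : numFieldType) (N : nat).
Implicit Types (U : seq 'I_N).

(** Induction on the first letter. A flagged letter of a colour already counted [c] times turns [c!]
    into [(c+1)!], which is the weight [1 + c] of [wsum]; an unflagged letter is free and sums to a
    power sum. *)
Lemma words_sum l (flag : 'I_l -> bool) (w : 'I_l -> nat) U :
  \sum_(c : l.-tuple 'I_N) (\prod_k 'X_(tnth c k) ^+ w k) *+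
      (\prod_j (count_mem j U + \sum_k (flag k && (tnth c k == j)))`!)
  = (\prod_(k | ~~ flag k) psum K N (w k))
    * wsum (1 : K) [seq w k | k <- enum 'I_l & flag k] U
    *+ (\prod_j (count_mem j U)`!).
Proof.
elim: l flag w U => [|l IH] flag w U.
  have -> : [seq w k | k <- enum 'I_0 & flag k] = [::].
    by apply: size0nil; rewrite size_map size_filter; apply/eqP;
       rewrite -leqn0 (leq_trans (count_size _ _)) // size_enum_ord.
  rewrite big_ord0 mulr1 /wsum.
  rewrite (eq_bigr (fun=> 1 *+ \prod_j (count_mem j U)`!)); last first.
    move=> c _; rewrite big_ord0; congr (_ *+ _); apply: eq_bigr => j _.
    by rewrite big_ord0 addn0.
  by rewrite big_const card_tuple expn0 /= addr0.
rewrite big_tuple_cons.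
pose flag' k := flag (lift ord0 k); pose w' k := w (lift ord0 k).
have prodE (a : 'I_N) (c : l.-tuple 'I_N) :
   \prod_k ('X_(tnth [tuple of a :: c] k) : {mpoly K[N]}) ^+ w k
   = 'X_a ^+ w ord0 * \prod_k 'X_(tnth c k) ^+ w' k.
  by rewrite big_ord_recl tnth0; congr (_ * _); apply: eq_bigr => k _; rewrite tnthS.
have cntE (a j : 'I_N) (c : l.-tuple 'I_N) : (\sum_k (flag k && (tnth [tuple of a :: c] k == j))
   = (flag ord0 && (a == j)) + \sum_k (flag' k && (tnth c k == j)))%N.
  by rewrite big_ord_recl tnth0; congr addn; apply: eq_bigr => k _; rewrite tnthS.
rewrite enum_ordSl /=.
have -> : \prod_(k | ~~ flag k) psum K N (w k) =
    (if ~~ flag ord0 then psum K N (w ord0) else 1) * \prod_(k | ~~ flag' k) psum K N (w' k).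
  by rewrite big_mkcond big_ord_recl -big_mkcond.
have -> : [seq x <- [seq lift ord0 i | i <- enum 'I_l] | flag x]
    = [seq lift ord0 i | i <- enum 'I_l & flag' i] by rewrite filter_map.
case fl: (flag ord0) => /=.
  rewrite mul1r -map_comp wsum_cons mulr_sumr -sumrMnl; apply: eq_bigr => a _.
  transitivity (('X_a ^+ w ord0 : {mpoly K[N]}) *
    \sum_(c : l.-tuple 'I_N) (\prod_k 'X_(tnth c k) ^+ w' k) *+
      (\prod_j (count_mem j (a :: U) + \sum_k (flag' k && (tnth c k == j)))`!)).
    rewrite mulr_sumr; apply: eq_bigr => c _; rewrite prodE -mulrnAr; congr (_ * (_ *+ _)).
    by apply: eq_bigr => j _; rewrite cntE fl /= addnA [(_ + (a == j))%N]addnC.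
  rewrite IH.
  have -> : (\prod_j (count_mem j (a :: U))`! = (count_mem a U).+1 * \prod_j (count_mem j U)`!)%N.
    rewrite (bigD1 a) //= [in RHS](bigD1 a) //= eqxx add1n factS -mulnA; congr (_ * (_ * _))%N.
    by apply: eq_bigr => j ja; rewrite eq_sym (negbTE ja).
  rewrite mulrnA mulrnAr; congr (_ *+ _).
  by rewrite nat1r scaler_nat !mulrnAr mulrCA.
rewrite -map_comp -mulrA -mulrnAr mulr_suml; apply: eq_bigr => a _.
rewrite -[X in _ * X]IH mulr_sumr; apply: eq_bigr => c _; rewrite prodE -mulrnAr.
congr (_ * (_ *+ _)); apply: eq_bigr => j _; by rewrite cntE fl.
Qed.
End Colorings.

(** A colouring constant on blocks is a word with one letter per block, weighted by the block size.
    The flagged blocks are those meeting [D], each in a single point; [rep] ensures that no block is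
    empty. *)
Lemma block_sum (K : numFieldType) N (T : finType) l (blk : T -> 'I_l) (rep : 'I_l -> T)
    (flag : 'I_l -> bool) (D : {set T}) :
  cancel rep blk -> (forall k, #|[set t in D | blk t == k]| = flag k) ->
  \sum_(f : {ffun T -> 'I_N} | [forall x, forall y, (blk x == blk y) ==> (f x == f y)])
     (\prod_t 'X_(f t)) *+ \prod_j (#|[set t in D | f t == j]|)`!
  = (\prod_(k | ~~ flag k) psum K N #|[set t | blk t == k]|)
    * wsum (1 : K) [seq #|[set t | blk t == k]| | k <- enum 'I_l & flag k] [::].
Proof.
move=> repK flagE; have := words_sum K flag (fun k => #|[set t | blk t == k]|) ([::] : seq 'I_N).
rewrite [X in _ *+ X](big1 _ _ (fun=> 1%N)) // mulr1n => <-.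
rewrite (reindex_onto (fun c : l.-tuple 'I_N => [ffun x => tnth c (blk x)])
   (fun f => [tuple f (rep k) | k < l])) /=; last first.
  move=> f /forallP fP; apply/ffunP => x; rewrite ffunE tnth_mktuple.
  by have /forallP/(_ x)/implyP/(_ _)/eqP := fP (rep (blk x)); apply; rewrite repK.
apply: eq_big => [c|c _].
  apply/andP; split.
    by apply/forallP => x; apply/forallP => y; apply/implyP => /eqP xy; rewrite !ffunE xy.
  by apply/eqP/eq_from_tnth => k; rewrite tnth_mktuple ffunE repK.
congr (_ *+ _).
  rewrite (partition_big blk xpredT) //=; apply: eq_bigr => k _.
  rewrite -prodr_const; apply: eq_big => [t|t /eqP tk]; first by rewrite inE.
  by rewrite ffunE tk.
apply: eq_bigr => j _; congr (_`!); rewrite add0n.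
rewrite -sum1_card (partition_big blk xpredT) //=; apply: eq_bigr => k _.
have [kj|kj] := boolP (tnth c k == j).
  rewrite andbT -flagE -sum1_card; apply: eq_bigl => t; rewrite !inE ffunE -andbA; congr (_ && _).
  by rewrite andb_idl // => /eqP ->.
rewrite andbF big1 // => t; rewrite !inE ffunE => /andP[/andP[_ +] /eqP tk].
by rewrite tk (negbTE kj).
Qed.

Section Extensions.
Variables (T S : finType).
Implicit Types (g : {ffun T -> option T}) (f : T -> S) (w : {perm T}).

Definition pinj g := forall i j k, g i = Some k -> g j = Some k -> i = j.
Definition extends w g := [forall i, forall j, (g i == Some j) ==> (w i == j)].
Definition compat g f := forall i j, g i = Some j -> f j = f i.

(** Inside a colour class [g] is a bijection from the points of its domain to those of its image, so
    the complements have equal size. *)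
Lemma card_nondom_nonim g f c : pinj g -> compat g f ->
  #|[set i | (g i == None) && (f i == c)]|
  = #|[set j | [forall i, g i != Some j] && (f j == c)]|.
Proof.
move=> gI gf.
pose h i := odflt i (g i).
pose A := [set i | (g i != None) && (f i == c)].
pose F := [set i | f i == c].
have hI : {in A &, injective h}.
  move=> i j; rewrite !inE /h; case gi: (g i) => [k|] //; case gj: (g j) => [k'|] //= _ _ kk.
  by apply: gI gi _; rewrite kk.
have -> : [set i | (g i == None) && (f i == c)] = F :\: A.
  by apply/setP => i; rewrite !inE negb_and negbK; case: (f i == c); rewrite ?andbT ?andbF ?orbF.
have -> : [set j | [forall i, g i != Some j] && (f j == c)] = F :\: h @: A.
  apply/setP => j; rewrite !inE; case: (boolP (f j == c)) => fj; rewrite ?andbF ?andbT //.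
  apply/forallP/negP => [gj /imsetP[i]|hA i].
    rewrite inE /h => /andP[gi _]; have := gj i.
    by case: (g i) gi => //= k _ + jk; rewrite jk eqxx.
  apply/eqP => gi; apply: hA; apply/imsetP; exists i; last by rewrite /h gi.
  by rewrite inE gi /= -(gf _ _ gi).
have AF : A \subset F by apply/subsetP => i; rewrite !inE => /andP[].
have hAF : h @: A \subset F.
  apply/subsetP => _ /imsetP[i + ->]; rewrite !inE /h.
  by case gi: (g i) => [k|] //= /eqP <-; rewrite (gf _ _ gi).
by rewrite !cardsDS // card_in_imset.
Qed.

Lemma extendsP w g : reflect (forall i j, g i = Some j -> w i = j) (extends w g).
Proof.
apply: (iffP forallP) => [wg i j gi|wg i]; last first.
  by apply/forallP => j; apply/implyP => /eqP /wg ->.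
by have /forallP/(_ j) := wg i; rewrite gi eqxx => /eqP.
Qed.

(** Induction on the number of points outside the domain. Such a point [i0] may go to any unattained
    point of its colour; by [card_nondom_nonim] there are as many as free points of that colour, a
    number that each choice lowers by one. *)
Lemma card_extensions g f : pinj g -> compat g f ->
  #|[set w | extends w g && [forall i, f (w i) == f i]]|
  = (\prod_c (#|[set i | (g i == None) && (f i == c)]|)`!)%N.
Proof.
have [k] := ubnP #|[set i | g i == None]|; elim: k g => // k IH g gk gI gf.
have [gT|[i0]] := set_0Vmem [set i | g i == None].
  pose h i := odflt i (g i).
  have gh i : g i = Some (h i).
    have : i \notin [set i | g i == None] by rewrite gT inE.
    by rewrite inE /h; case: (g i).
  have hI : injective h.
    by move=> i j hij; apply: (gI i j (h i)); rewrite gh // hij.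
  rewrite big1 => [|c _]; last first.
    rewrite (_ : [set _ | _] = set0) ?cards0 //.
    by apply/setP => i; rewrite !inE gh.
  rewrite (_ : [set w | _] = [set perm hI]) ?cards1 //.
  apply/setP => w; rewrite !inE; apply/andP/eqP => [[/extendsP wg _]|->].
    by apply/permP => i; rewrite permE; apply: wg.
  split; first by apply/extendsP => i j; rewrite gh permE => -[].
  by apply/forallP => i; rewrite permE (gf _ _ (gh i)).
rewrite inE => /eqP gi0.
pose J := [set j | [forall i, g i != Some j] && (f j == f i0)].
pose upd j : {ffun T -> option T} := [ffun i => if i == i0 then Some j else g i].
have nd j c : #|[set i | (g i == None) && (f i == c)]|
    = ((f i0 == c) + #|[set i | (upd j i == None) && (f i == c)]|)%N.
  rewrite (cardsD1 i0) inE gi0 eqxx /=; congr addn; apply: eq_card => i.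
  by rewrite !inE ffunE; case: (i == i0); rewrite ?andbF.
have updE j : j \in J -> #|[set w | extends w (upd j) && [forall i, f (w i) == f i]]|
    = (\prod_c (#|[set i | (upd j i == None) && (f i == c)]|)`!)%N.
  rewrite inE => /andP[/forallP jim /eqP fj]; apply: IH.
  - rewrite -ltnS; apply: leq_trans gk; rewrite ltnS [X in (_ < X)%N](cardsD1 i0) inE gi0 eqxx ltnS.
    apply: subset_leq_card; apply/subsetP => i; rewrite !inE ffunE.
    by case: (i == i0).
  - move=> i i' j'; rewrite !ffunE.
    have [->|ii] := eqVneq i i0; have [->|ii'] := eqVneq i' i0 => //.
    + by case=> <- gi'; have := jim i'; rewrite gi' eqxx.
    + by move=> gi [jj]; have := jim i; rewrite gi jj eqxx.
    + exact: gI.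
  - move=> i j'; rewrite ffunE; have [->|ii] := eqVneq i i0; first by case=> <-.
    exact: gf.
transitivity (\sum_(j in J) #|[set w | extends w (upd j) && [forall i, f (w i) == f i]]|)%N.
  rewrite -sum1_card (partition_big (fun w : {perm T} => w i0) (mem J)) /=; last first.
    move=> w; rewrite !inE => /andP[/extendsP wg /forallP wf]; rewrite wf andbT.
    apply/forallP => i; apply/eqP => gi; have /perm_inj ii := wg _ _ gi.
    by rewrite -ii gi in gi0.
  apply: eq_bigr => j jJ; rewrite -sum1_card; apply: eq_bigl => w; rewrite !inE.
  rewrite andbAC; congr (_ && _); apply/andP/extendsP => [[/extendsP wg /eqP wj] i i'|wg].
    by rewrite ffunE; case: eqP => [-> [<-]|_ /wg].
  split; last by apply/eqP/wg; rewrite ffunE eqxx.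
  apply/extendsP => i i' gi; apply: wg; rewrite ffunE; case: eqP => // ii.
  by rewrite -ii gi in gi0.
pose nd' c := #|[set i | (g i == None) && (f i == c)]|.
rewrite (eq_bigr (fun=> \prod_c (nd' c - (f i0 == c))`!))%N; last first.
  by move=> j jJ; rewrite updE //; apply: eq_bigr => c _; rewrite /nd' (nd j) addKn.
rewrite sum_nat_const -card_nondom_nonim // -/(nd' _).
have : (0 < nd' (f i0))%N by apply/card_gt0P; exists i0; rewrite inE gi0 !eqxx.
rewrite (bigD1 (f i0)) //= [in RHS](bigD1 (f i0)) //= -/(nd' _) eqxx.
case: (nd' (f i0)) => // a _; rewrite subn1 mulnA -factS; congr (_ * _)%N.
by apply: eq_bigr => c cf; rewrite eq_sym (negbTE cf) subn0.
Qed.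
End Extensions.

(** * Components of a partial permutation are paths or cycles *)

Section Components.
Variables (n : nat) (g : partial_perm n).
Implicit Types (i j x : 'I_n) (C : {set 'I_n}) (t : seq 'I_n).

Definition uedge : rel 'I_n := fun i j => edge g i j || edge g j i.

Lemma uedge_sym : connect_sym uedge.
Proof. by apply: sym_connect_sym => i j; rewrite /uedge orbC. Qed.

Lemma uedge_equiv : {in [set: 'I_n] & &, equivalence_rel (connect uedge)}.
Proof.
move=> x y z _ _ _; split; first exact: connect0.
move=> xy; exact: (same_connect uedge_sym xy z).
Qed.

Lemma components_partition : partition (components g) [set: 'I_n].
Proof. exact: equivalence_partitionP uedge_equiv. Qed.

Lemma mem_pblock_components x y : (y \in pblock (components g) x) = connect uedge x y.
Proof. by rewrite (pblock_equivalence_partition uedge_equiv) ?inE. Qed.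

Lemma edge_fun i j k : edge g i j -> edge g i k -> j = k.
Proof. by rewrite /edge => /eqP -> /eqP[]. Qed.

Lemma edge_inj i j k : edge g i k -> edge g j k -> i = j.
Proof. by rewrite /edge => /eqP gi /eqP gj; apply: pp_injP gi gj. Qed.

Lemma path_succ a s i : path (edge g) a s -> i \in a :: s -> i != last a s ->
  exists2 j, j \in a :: s & edge g i j.
Proof.
move=> as_ ias; case/splitPl: ias as_ => p1 [|b p2] <-; first by rewrite cats0 eqxx.
rewrite cat_path /= => /and3P[_ e _] _; exists b => //.
by rewrite inE mem_cat inE eqxx !orbT.
Qed.

Lemma path_pred a s j : path (edge g) a s -> j \in s ->
  exists2 i, i \in a :: s & edge g i j.
Proof.
move=> as_ js; case/splitPr: js as_ => p1 p2.
rewrite cat_path /= => /and3P[_ e _]; exists (last a p1) => //.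
by rewrite -cat_cons mem_cat mem_last.
Qed.

(* Obtained as an edge path through [x] of maximal length. *)
Lemma component_path x : exists a s, [/\ x \in a :: s, uniq (a :: s), path (edge g) a s
  & forall i j, edge g i j -> (i \in a :: s) = (j \in a :: s)].
Proof.
pose P m := [exists t : m.-tuple 'I_n, [&& x \in t, uniq t & sorted (edge g) t]].
have P1 : exists m, P m.
  by exists 1%N; apply/existsP; exists [tuple x]; rewrite inE eqxx.
have Pn m : P m -> (m <= n)%N.
  case/existsP=> t /and3P[_ tu _].
  by have := max_card (mem t); rewrite (card_uniqP tu) size_tuple card_ord.
case: (ex_maxnP P1 Pn) => m /existsP[t0 /and3P[]] + + + max.
have [t tm] : {t : seq 'I_n | t = t0} by exists t0.
rewrite -tm => xt tu ts; have {}xt : x \in t by rewrite tm.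
move: xt tu ts.
have {tm} tm : size t = m by rewrite tm size_tuple.
case: t tm => [|a s] tm; first by rewrite in_nil.
move=> xt tu ts; have {}ts : path (edge g) a s := ts.
exists a, s.
have Pt t' : x \in t' -> uniq t' -> sorted (edge g) t' -> (size t' <= size (a :: s))%N.
  move=> x' u' s'; rewrite tm; apply: max; apply/existsP; exists (in_tuple t').
  by apply/and3P.
split => // i j gij.
(* An edge leaving the last vertex or entering the first one stays in the path, as it would
   otherwise prolong it; the other edges are determined by the path. *)
apply/idP/idP => [it|jt].
  have [il|il] := eqVneq i (last a s); last first.
    by have [j' j's gij'] := path_succ ts it il; rewrite (edge_fun gij gij').
  apply: contraT => jt; have := Pt (rcons (a :: s) j).
  rewrite mem_rcons inE xt orbT rcons_uniq jt tu size_rcons ltnn => /(_ isT isT); apply.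
  by rewrite /= rcons_path ts -il.
move: jt; rewrite inE => /predU1P[ja|js]; last first.
  by have [i' i's gi'j] := path_pred ts js; rewrite (edge_inj gij gi'j).
apply: contraT => it; have := Pt (i :: a :: s).
rewrite [x \in _]in_cons xt orbT cons_uniq it tu => /(_ isT isT).
by rewrite ltnn; apply; rewrite /= -ja gij ja.
Qed.

Lemma component_path_connect a s i : path (edge g) a s -> i \in a :: s -> connect uedge a i.
Proof.
move=> as_ ias; case/splitPl: ias as_ => p1 p2 <-.
rewrite cat_path => /andP[p1e _]; apply/connectP; exists p1 => //.
by apply: sub_path p1e => u v; rewrite /uedge => ->.
Qed.

Lemma components_pathP C : C \in components g -> exists a s, [/\ C = [set i in a :: s],
  uniq (a :: s), path (edge g) a s
  & forall i j, edge g i j -> (i \in a :: s) = (j \in a :: s)].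
Proof.
move=> CP; have [_ triv nz] := and3P components_partition.
have [C0|[x xC]] := set_0Vmem C; first by rewrite -C0 CP in nz.
have [a [s [xas u p cl]]] := component_path x; exists a, s; split => //.
rewrite -(def_pblock triv CP xC); apply/setP => y.
rewrite mem_pblock_components inE.
have xa := component_path_connect p xas.
apply/idP/idP => [xy|yas].
  have clo : closed uedge (mem (a :: s)).
    by move=> i j /orP[] e; [exact: cl|rewrite (cl _ _ e)].
  by rewrite -(closed_connect clo xy).
apply: connect_trans (component_path_connect p yas).
by rewrite uedge_sym.
Qed.

Lemma dicycle_dom C i : C \in components g -> is_dicycle g C -> i \in C -> g i != None.
Proof.
move=> CP /existsP[t /and3P[tu /eqP CE /forallP tC]] iC.
have it : i \in (t : seq _) by move: iC; rewrite [in X in X -> _]CE inE.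
have nC : next t i \in C by rewrite [in X in _ \in X]CE inE mem_next.
have /implyP/(_ iC)/forallP/(_ (next t i))/implyP/(_ nC) := tC i.
by rewrite eqxx => /eqP/eqP ->.
Qed.

Lemma components_closed C i j : C \in components g -> edge g i j -> i \in C -> j \in C.
Proof.
move=> CP gij; have [_ triv nz] := and3P components_partition => iC.
rewrite -(def_pblock triv CP iC) mem_pblock_components.
by apply: connect1; rewrite /uedge gij.
Qed.

Lemma dipath_nondom C : C \in components g -> is_dipath g C -> exists2 i, i \in C & g i = None.
Proof.
move=> CP /existsP[t /and3P[tu /eqP CE /forallP tC]].
have [_ triv nz] := and3P components_partition.
have [C0|[x xC]] := set_0Vmem C; first by rewrite -C0 CP in nz.
have C0 : (0 < size t)%N by rewrite size_tuple; apply/card_gt0P; exists x.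
pose e := nth x t (size t).-1.
have et : e \in (t : seq _) by rewrite mem_nth // prednK.
have eC : e \in C by rewrite [in X in _ \in X]CE inE.
exists e => //; case ge: (g e) => [j|] //.
have gej : edge g e j by rewrite /edge ge.
have jC := components_closed CP gej eC.
have jt : j \in (t : seq _) by move: jC; rewrite [in X in X -> _]CE inE.
have /implyP/(_ eC)/forallP/(_ j)/implyP/(_ jC) := tC e.
rewrite gej eq_sym eqb_id index_uniq ?prednK // => /eqP jE.
by move: jt; rewrite -index_mem jE ltnn.
Qed.

Lemma path_edge_index a s i : path (edge g) a s -> uniq (a :: s) -> i \in a :: s ->
  i != last a s ->
  edge g i (nth a s (index i (a :: s)))
  /\ index (nth a s (index i (a :: s))) (a :: s) = (index i (a :: s)).+1.
Proof.
move=> p u ias il; set k := index i (a :: s).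
have ik : nth a (a :: s) k = i by rewrite nth_index.
have ks : (k < size s)%N.
  have : (k < (size s).+1)%N by rewrite -[(size s).+1]/(size (a :: s)) index_mem.
  rewrite ltnS leq_eqVlt => /predU1P[e|//]; case/eqP: il.
  by rewrite -ik e -[size s]/(size (a :: s)).-1 nth_last.
split; last by rewrite -[nth a s _]/(nth a (a :: s) k.+1) index_uniq.
by have := pathP a p _ ks; rewrite ik.
Qed.

(** An edge path runs through all of [C], so everything depends on its last vertex. If [g] is
    defined there, its value is the first vertex, any other one having a predecessor already, and
    [C] is a cycle; if not, [C] is a path whose only point outside the domain is that vertex. *)
Lemma component_class C : C \in components g ->
  is_dicycle g C = ~~ is_dipath g C
  /\ #|[set i in C | g i == None]| = is_dipath g C :> nat.
Proof.
move=> CP; have [a [s [CE u p cl]]] := components_pathP CP.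
have sizeC : size (a :: s) = #|C| by rewrite CE cardsE (card_uniqP u).
pose t : #|C|.-tuple 'I_n := tcast sizeC (in_tuple (a :: s)).
have tE : t = a :: s :> seq _ by rewrite val_tcast.
have CtE : C == [set i in t].
  by apply/eqP; rewrite [LHS]CE; apply/setP => i; rewrite [LHS]inE [RHS]inE memtE tE.
have inC i : (i \in C) = (i \in a :: s) by rewrite CE inE.
case gl: (g (last a s)) => [b|].
  have cyc : is_dicycle g C.
    apply/existsP; exists t; apply/and3P; split; rewrite ?CtE ?tE //.
    apply/forallP => i; apply/implyP; rewrite inC => iC.
    apply/forallP => j; apply/implyP => jC; apply/eqP.
    suff gi : edge g i (next (a :: s) i).
      by apply/idP/eqP => [/(edge_fun gi) ->|->].
    rewrite next_nth iC.
    have [il|il] := eqVneq i (last a s).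
      have -> : nth a s (index i (a :: s)) = a by rewrite il index_last ?nth_default.
      have bs : b \in a :: s by rewrite -(cl (last a s)) ?mem_last // /edge gl.
      move: bs; rewrite inE => /predU1P[<-|bs]; first by rewrite /edge il gl.
      have kb : (index b s < size s)%N by rewrite index_mem.
      have := pathP a p _ kb; rewrite nth_index // => gq.
      have qs : (index b s < size (a :: s))%N by apply: ltnW.
      have ql : nth a (a :: s) (index b s) = last a s by apply: edge_inj gq _; rewrite /edge gl.
      have := index_uniq a qs u; rewrite ql index_last // => e.
      by move: kb; rewrite -e ltnn.
    by have [] := path_edge_index p u iC il.
  have np : is_dipath g C = false.
    by apply/negbTE/negP => /(dipath_nondom CP)[i iC gi]; have := dicycle_dom CP cyc iC; rewrite gi.
  split; first by rewrite cyc np.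
  rewrite np; apply/eqP; rewrite cards_eq0; apply/eqP/setP => i; rewrite !inE.
  by apply/negP => /andP[iC gi]; have := dicycle_dom CP cyc iC; rewrite gi.
have dp : is_dipath g C.
  apply/existsP; exists t; apply/and3P; split; rewrite ?CtE ?tE //.
  apply/forallP => i; apply/implyP; rewrite inC => iC.
  apply/forallP => j; apply/implyP; rewrite inC => jC; apply/eqP.
  apply/idP/eqP => [gij|ji].
    have il : i != last a s.
      by apply/eqP => il; move: gij; rewrite /edge il gl.
    have [gi <-] := path_edge_index p u iC il.
    by rewrite (edge_fun gij gi).
  have il : i != last a s.
    apply/eqP => il; move: jC; rewrite -index_mem ji il index_last //=.
    by rewrite ltnn.
  have [gi ij] := path_edge_index p u iC il.
  suff -> : j = nth a s (index i (a :: s)) by [].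
  by rewrite -[LHS](nth_index a jC) ji.
have nc : is_dicycle g C = false.
  apply/negbTE/negP => cyc; have lC : last a s \in C by rewrite inC mem_last.
  by have := dicycle_dom CP cyc lC; rewrite gl.
split; rewrite ?nc dp //.
apply/eqP/cards1P; exists (last a s); apply/setP => i; rewrite !inE inC.
apply/andP/eqP => [[ias gi]|->]; last by rewrite mem_last gl.
apply/eqP; apply: contraT => il; have [j _] := path_succ p ias il.
by rewrite /edge (eqP gi).
Qed.
End Components.

Lemma map_enum_val (T : finType) (A : {set T}) : [seq enum_val k | k <- enum 'I_#|A|] = enum A.
Proof.
have [e|] := eqVneq (enum A) [::].
  by rewrite e; apply: size0nil; rewrite size_map size_enum_ord cardE e.
case eA: (enum A) => [|x0 s] // _; rewrite -eA.
apply: (@eq_from_nth _ x0); rewrite size_map size_enum_ord ?cardE // => i ilt.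
rewrite (nth_map (Ordinal ilt)) ?size_enum_ord // (enum_val_nth x0).
by rewrite nth_enum_ord // cardE.
Qed.

(** * Sums over colourings constant on the blocks of a partition *)

Section PartitionSum.
Variables (K : numFieldType) (N : nat).

Lemma partition_sum (T : finType) (P : {set {set T}}) (flag : {set T} -> bool) (D : {set T}) :
  partition P [set: T] -> (forall C, C \in P -> #|[set t in C | t \in D]| = flag C) ->
  \sum_(f : {ffun T -> 'I_N} | [forall x, forall y, (y \in pblock P x) ==> (f x == f y)])
     (\prod_t 'X_(f t)) *+ \prod_j (#|[set t in D | f t == j]|)`!
  = (\prod_(C in P | ~~ flag C) psum K N #|C|)
    * wsum (1 : K) [seq #|C| | C : {set T} <- enum P & flag C] [::].
Proof.
move=> parP flagE; have [/eqP covP triv P0] := and3P parP.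
have bP x : pblock P x \in P by rewrite pblock_mem // covP inE.
pose blk x : 'I_#|P| := enum_rank_in (bP x) (pblock P x).
have blkK x : enum_val (blk x) = pblock P x by rewrite enum_rankK_in.
have kP (k : 'I_#|P|) : enum_val k \in P by exact: (enum_valP k).
have blkE x k : (blk x == k) = (x \in enum_val k).
  apply/eqP/idP => [<-|xk]; first by rewrite blkK mem_pblock covP inE.
  apply: enum_val_inj; rewrite blkK; exact: def_pblock triv (kP k) xk.
have ne (k : 'I_#|P|) : exists x, x \in (enum_val k : {set T}).
  apply/set0Pn; apply: contraNneq P0 => e. by rewrite -e kP.
pose rep k := xchoose (ne k).
have repK : cancel rep blk.
  by move=> k; apply/eqP; rewrite blkE; apply: xchooseP.
have cardE' k : #|[set t | blk t == k]| = #|(enum_val k : {set T})|.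
  by apply: eq_card => x; rewrite inE blkE.
have flagE' (k : 'I_#|P|) : #|[set t in D | blk t == k]| = flag (enum_val k).
  rewrite -flagE ?kP //; apply: eq_card => x; rewrite !inE blkE andbC //.
rewrite big_enum_val_cond -map_enum_val.
have := block_sum K N repK flagE'.
under [X in _ = X * _ -> _]eq_bigr => k _ do rewrite cardE'.
have -> : [seq #|[set t | blk t == k]| | k <- enum 'I_#|P| & flag (enum_val k)]
   = [seq #|C| | C : {set T} <- [seq enum_val k | k <- enum 'I_#|P|] & flag C].
  by rewrite [in RHS]filter_map -[in RHS]map_comp; apply: (eq_map cardE').
move=> <-; apply: eq_bigl => f.
have E x y : (blk x == blk y) = (y \in pblock P x) by rewrite eq_sym blkE blkK.
by apply/forallP/forallP => H x; apply/forallP => y; have /forallP/(_ y) := H x; rewrite E.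
Qed.

Lemma porbits_partition (T : finType) (w : {perm T}) : partition (porbits w) [set: T].
Proof.
apply/and3P; split.
- apply/eqP/setP => x; rewrite !inE.
  by apply/bigcupP; exists (porbit w x); [apply: imset_f|apply: porbit_id].
- apply/trivIsetP => _ _ /imsetP[x _ ->] /imsetP[y _ ->].
  apply: contraNT => /pred0Pn[z /= /andP[]].
  by rewrite -!eq_porbit_mem => /eqP -> /eqP ->.
- by apply/imsetP => -[x _ /setP/(_ x)]; rewrite inE porbit_id.
Qed.

(* Unqualified, [perm_type] is the carrier of the permutation groups of MathComp. *)
Lemma perm_type_pos n (w : 'S_n) : 0%N \notin Defs.perm_type w.
Proof.
have [_ _ P0] := and3P (porbits_partition w).
rewrite mem_sort; apply/mapP => -[C]; rewrite mem_enum => CP /esym/eqP.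
by rewrite cards_eq0 => /eqP C0; rewrite -C0 CP in P0.
Qed.

(** The case of [partition_sum] with the orbits as blocks and nothing flagged: all factorials are
    [0!], and [f] is constant on orbits iff it is invariant under [w]. *)
Lemma in_vars_p_perm n (w : 'S_n) :
  in_vars (sym_p K (Defs.perm_type w)) N
  = \sum_(f : {ffun 'I_n -> 'I_N} | [forall i, f (w i) == f i]) \prod_i 'X_(f i).
Proof.
have parP := porbits_partition w; have [_ triv _] := and3P parP.
have pblockE x : pblock (porbits w) x = porbit w x.
  by apply: def_pblock; rewrite ?imset_f ?porbit_id.
have := @partition_sum _ (porbits w) (fun=> false) set0 parP.
have -> : [seq #|C| | C : {set 'I_n} <- enum (porbits w) & false] = [::].
  by rewrite filter_pred0.
have D0 C : C \in porbits w -> #|[set t in C | t \in (set0 : {set 'I_n})]| = false.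
  by move=> _; apply/eqP; rewrite cards_eq0; apply/eqP/setP => x; rewrite !inE andbF.
move=> /(_ D0) S.
rewrite in_vars_p ?perm_type_pos //.
rewrite (perm_big _ (permEl (perm_sort _ _))) /= big_map big_enum /=.
transitivity (\prod_(C in porbits w | true) psum K N #|C|).
  by apply: eq_bigl => C; rewrite andbT.
move: S; rewrite /wsum mulr1 => <-.
apply: eq_big => [f|f _]; last first.
  rewrite [X in _ *+ X]big1 ?mulr1n // => j _; rewrite (_ : [set t in _ | _] = set0) ?cards0 //.
  by apply/setP => x; rewrite !inE.
apply/forallP/forallP => [H x|H x].
  have /forallP/(_ (w x))/implyP := H x; rewrite pblockE (mem_porbit w 1 x) => /(_ isT).
  by rewrite eq_sym.
apply/forallP => y; apply/implyP; rewrite pblockE => /porbitP[i ->].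
elim: i => [|i IH]; first by rewrite expg0 perm1.
by rewrite expgSr permM (eqP (H _)).
Qed.
End PartitionSum.

(** After exchanging the sums, each colouring counts the extensions preserving it: none unless it is
    constant on components, and otherwise the number in [card_extensions]. The set [D] of points
    outside the domain meets every path once and no cycle. *)
Lemma sum_extends (K : numFieldType) n N (g : partial_perm n) :
  \sum_(w : 'S_n | extends w (pp_map g)) in_vars (sym_p K (Defs.perm_type w)) N
  = in_vars (sym_p K (cycle_type g)) N *
    wsum (1 : K) [seq #|C| | C : {set 'I_n} <- enum (components g) & is_dipath g C] [::].
Proof.
under eq_bigr => w _ do rewrite in_vars_p_perm.
rewrite (exchange_big_dep xpredT) //=.
have gI : pinj (pp_map g) := @pp_injP _ g.
pose D := [set i | g i == None].
have parP := components_partition g; have [_ triv P0] := and3P parP.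
have flagE C : C \in components g -> #|[set t in C | t \in D]| = is_dipath g C.
  by move=> /component_class[_ <-]; apply: eq_card => i; rewrite !inE.
have compatE (f : {ffun 'I_n -> 'I_N}) :
  reflect (compat (pp_map g) f)
   [forall x, forall y, (y \in pblock (components g) x) ==> (f x == f y)].
  apply: (iffP forallP) => [H i j gij|H x].
    have /forallP/(_ j)/implyP Hj := H i; apply/esym/eqP/Hj.
    by rewrite mem_pblock_components; apply: connect1; rewrite /uedge /edge gij eqxx.
  apply/forallP => y; apply/implyP; rewrite mem_pblock_components => xy.
  have clo : closed (uedge g) [pred z | f z == f x].
    move=> i j ij; rewrite !inE; suff -> : f i = f j by [].
    by case/orP: ij => /eqP /H.
  by have := closed_connect clo xy; rewrite !inE eqxx eq_sym => <-.
have := partition_sum K N parP flagE.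
have -> : \prod_(C in components g | ~~ is_dipath g C) psum K N #|C|
   = in_vars (sym_p K (cycle_type g)) N.
  rewrite in_vars_p.
    rewrite (perm_big _ (permEl (perm_sort _ _))) /= big_map big_filter big_enum_cond /=.
    by apply: eq_bigl => C; case: (boolP (C \in _)) => //= /component_class[-> _].
  rewrite mem_sort; apply/mapP => -[C]; rewrite mem_filter mem_enum => /andP[_ CP] /esym/eqP.
  by rewrite cards_eq0 => /eqP C0; rewrite -C0 CP in P0.
move=> <-; rewrite [RHS]big_mkcond; apply: eq_bigr => f _.
rewrite sumr_const; case: compatE => gf; last first.
  rewrite (_ : #|_| = 0%N) ?mulr0n //; apply: eq_card0 => w; apply/negbTE/negP.
  rewrite unfold_in /= => /andP[/extendsP wg /forallP wf]; apply: gf => i j gi.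
  by rewrite -(wg _ _ gi); apply/eqP.
congr (_ *+ _); rewrite -[LHS]cardsE (card_extensions gI gf).
by apply: eq_bigr => j _; congr (_`!); apply: eq_card => i; rewrite !inE.
Qed.

(** * Conjugacy of permutations of equal cycle type, and the sum over all permutations *)

Lemma perm_map_bij (T : eqType) (s t : seq T) (h : T -> nat) (x0 : T) :
  perm_eq [seq h x | x <- s] [seq h x | x <- t] ->
  exists2 t', perm_eq t t' & [seq h x | x <- s] = [seq h x | x <- t'].
Proof.
case/(perm_iotaP (h x0)) => Is; rewrite size_map => pI ->.
exists [seq nth x0 t i | i <- Is].
  by rewrite -[X in perm_eq X _](mkseq_nth x0) perm_sym; apply: perm_map.
rewrite -map_comp; apply/eq_in_map => i iI.
by rewrite /= (nth_map x0) //; move: iI; rewrite (perm_mem pI) mem_iota.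
Qed.

Lemma porbits_bij (T : finType) (u w : {perm T}) :
  perm_eq [seq #|C| | C : {set T} <- enum (porbits u)]
          [seq #|C| | C : {set T} <- enum (porbits w)] ->
  exists phi : {set T} -> {set T},
    [/\ {in porbits u, forall C, phi C \in porbits w},
        {in porbits u, forall C, #|phi C| = #|C|} & {in porbits u &, injective phi}].
Proof.
case/(perm_map_bij (set0 : {set T})) => t' pt e.
have st : size (enum (porbits u)) = size t'.
  by have := congr1 size e; rewrite !size_map.
exists (fun C => nth set0 t' (index C (enum (porbits u)))); split.
- move=> C Cu; rewrite -[_ \in porbits w]mem_enum (perm_mem pt) mem_nth //.
  by rewrite -st index_mem mem_enum.
- move=> C Cu; have iC : (index C (enum (porbits u)) < size t')%N by rewrite -st index_mem mem_enum.
  have := congr1 (fun s => nth 0%N s (index C (enum (porbits u)))) e.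
  by rewrite /= !(nth_map set0) ?st // nth_index ?mem_enum.
move=> C C' Cu Cu' /eqP; rewrite nth_uniq -?st ?index_mem ?mem_enum //.
  move=> /eqP ii.
  rewrite -(nth_index set0 (s := enum (porbits u)) (x := C)) ?mem_enum // ii.
  by rewrite nth_index ?mem_enum.
by rewrite -(perm_uniq pt) enum_uniq.
Qed.

Lemma perm_type_conj n (u w : 'S_n) :
  perm_eq (Defs.perm_type u) (Defs.perm_type w) -> exists v, w = (u ^ v)%g.
Proof.
rewrite perm_sort perm_sym perm_sort perm_sym => /porbits_bij[phi [phiP phiC phiI]].
have [x0 _|n0] := pickP 'I_n; last first.
  by exists 1%g; apply/permP => x; have := n0 x.
pose pk (C : {set 'I_n}) := odflt x0 [pick y in C].
have pkP (C : {set 'I_n}) x : x \in C -> pk C \in C.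
  by rewrite /pk; case: pickP => //= nC; rewrite (nC x).
have Cu x : porbit u x \in porbits u by apply: imset_f.
have pk_u x : porbit u (pk (porbit u x)) = porbit u x.
  by apply/eqP; rewrite eq_porbit_mem; apply: pkP (porbit_id u x).
have pk_w x : porbit w (pk (phi (porbit u x))) = phi (porbit u x).
  have /imsetP[y _ ->] := phiP _ (Cu x).
  by apply/eqP; rewrite eq_porbit_mem; apply: pkP (porbit_id w y).
(* The orbit of [x] listed from its chosen point; [v] sends its entry of index [k] to the [k]-th
   iterate of [w] at the chosen point of the matching orbit. *)
pose tr x := traject u (pk (porbit u x)) #|porbit u x|.
pose v x := iter (index x (tr x)) w (pk (phi (porbit u x))).
have xtr x : x \in tr x.
  by rewrite /tr -{2}(pk_u x) -porbit_traject pk_u porbit_id.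
have itr x : (index x (tr x) < #|porbit u x|)%N.
  by rewrite -[X in (_ < X)%N](size_traject u (pk (porbit u x))) index_mem.
have xE x : x = iter (index x (tr x)) u (pk (porbit u x)).
  by rewrite -(nth_traject _ (itr x)) nth_index.
have tr_uniq x : uniq (tr x) by rewrite /tr -{2}(pk_u x) uniq_traject_porbit.
have porbit_v x : porbit w (v x) = phi (porbit u x).
  by rewrite /v -permX porbit_perm pk_w.
have vI : injective v.
  move=> x y vxy.
  have Cxy : porbit u x = porbit u y.
    by apply: phiI => //; rewrite -!porbit_v vxy.
  have trxy : tr x = tr y by rewrite /tr Cxy.
  have ixy : index x (tr x) = index y (tr y).
    have := uniq_traject_porbit w (pk (phi (porbit u x))); rewrite pk_w phiC // => un.
    have ix := itr x; have iy := itr y; rewrite -Cxy in iy.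
    apply/eqP; rewrite -(nth_uniq (pk (phi (porbit u x))) _ _ un) ?size_traject // !nth_traject //.
    by move: vxy; rewrite /v Cxy => ->.
  by rewrite (xE x) (xE y) ixy Cxy.
exists (perm vI); apply/permP => y.
rewrite -[y](permKV (perm vI)) permJ; set x := ((perm vI)^-1 y)%g.
rewrite !permE.
have Cux : porbit u (u x) = porbit u x by have := porbit_perm u 1 x; rewrite expg1.
have trux : tr (u x) = tr x by rewrite /tr Cux.
rewrite /v trux Cux -iterS.
(* If [x] is the last entry, both trajectories close up: [u x] is the chosen point, at index 0. *)
have := itr x; rewrite leq_eqVlt => /predU1P[e|lt].
  rewrite e.
  have -> : u x = pk (porbit u x).
    by have := iter_porbit u (pk (porbit u x)); rewrite pk_u -e iterS -xE.
  have -> : index (pk (porbit u x)) (tr x) = 0%N.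
    by rewrite /tr -e /= eqxx.
  by have := iter_porbit w (pk (phi (porbit u x))); rewrite pk_w phiC.
congr (iter _ w _).
have -> : u x = nth (pk (porbit u x)) (tr x) (index x (tr x)).+1.
  by rewrite nth_traject // iterS -xE.
by rewrite index_uniq ?size_traject.
Qed.

(** The analogue of [sum_extends] for the nowhere defined partial permutation: all blocks are
    singletons and flagged. *)
Lemma sum_perm_wsum (K : numFieldType) n N :
  \sum_(u : 'S_n) in_vars (sym_p K (Defs.perm_type u)) N
  = wsum (1 : K) (nseq n 1%N) ([::] : seq 'I_N).
Proof.
under eq_bigr => u _ do rewrite in_vars_p_perm.
rewrite (exchange_big_dep xpredT) //=.
pose g0 : {ffun 'I_n -> option 'I_n} := [ffun=> None].
have g0I : pinj g0 by move=> i j k; rewrite ffunE.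
have D1 (k : 'I_n) : #|[set t in [set: 'I_n] | t == k]| = true.
  by rewrite (_ : [set _ in _ | _] = [set k]) ?cards1 //; apply/setP => t; rewrite !inE.
have D1' (k : 'I_n) : #|[set t : 'I_n | t == k]| = 1%N.
  by rewrite (_ : [set _ | _] = [set k]) ?cards1 //; apply/setP => t; rewrite !inE.
have := @block_sum K N _ n id id (fun=> true) setT (fun=> erefl) D1.
rewrite big_pred0_eq mul1r.
have -> : [seq #|[set t : 'I_n | t == k]| | k <- enum 'I_n & true] = nseq n 1%N.
  rewrite filter_predT (eq_map D1') -[n in RHS](size_enum_ord n).
  by elim: (enum _) => //= a s ->.
move=> <-; rewrite [RHS]big_mkcond; apply: eq_bigr => f _.
have -> : [forall x, forall y, (x == y) ==> (f x == f y)].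
  by apply/forallP => x; apply/forallP => y; apply/implyP => /eqP ->.
rewrite sumr_const; congr (_ *+ _).
have fc : compat g0 f by move=> i j; rewrite ffunE.
transitivity #|[set w : 'S_n | extends w g0 && [forall i, f (w i) == f i]]|.
  rewrite cardsE; apply: eq_card => w; rewrite !unfold_in.
  suff -> : extends w g0 by [].
  by apply/extendsP => i j; rewrite ffunE.
rewrite card_extensions //; apply: eq_bigr => j _; congr (_`!).
by apply: eq_card => i; rewrite !inE ffunE.
Qed.

(** * Characters *)

Section Characters.
Variable K : numFieldType.
Variables (hall : {biscalar symfun K}) (omega : {lrmorphism symfun K -> symfun K}).
Hypotheses (hallP : is_hall hall) (omegaP : is_omega omega).

(** For a column of ones the sign is trivial and the augmented monomial is [n! e_n], which [omega]
    maps to [n! h_n]. *)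
Lemma sum_perm_p n : \sum_(u : 'S_n) sym_p K (Defs.perm_type u) = sym_h1 K n *+ n`!.
Proof.
apply: symfunP => N; rewrite in_vars_sum sum_perm_wsum.
rewrite -(in_vars_omega_aug omegaP); last by rewrite mem_nseq andbF.
rewrite sumn_nseq mul1n size_nseq subnn expr0 scale1r aug_nseq1 rmorphMn /=.
by rewrite omega_e1.
Qed.

Lemma sumn_perm_type n (w : 'S_n) : sumn (Defs.perm_type w) = n.
Proof.
rewrite sumnE (perm_big _ (permEl (perm_sort _ _))) /= big_map big_enum /=.
by rewrite -(card_partition (porbits_partition w)) cardsT card_ord.
Qed.

(** A term either vanishes by orthogonality or has [u] conjugate to [w], so [chi u] may be replaced
    by [chi w] in all of them; the remaining sum is [n! h_n], paired with [p_la] to [n!]. *)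
Lemma hall_frob_p n (chi : 'S_n -> K) (w : 'S_n) : class_function chi ->
  hall (frob_ch chi) (sym_p K (Defs.perm_type w)) = chi w.
Proof.
move=> chiC; have n0 : n`!%:R != 0 :> K by rewrite pnatr_eq0 -lt0n fact_gt0.
rewrite /frob_ch linearZl_LR hall_sumZl /=.
rewrite (eq_bigr (fun u => chi w * hall (sym_p K (Defs.perm_type u)) (sym_p K (Defs.perm_type w)))).
  rewrite -mulr_sumr -linear_sumlz sum_perm_p linearMnl hall_h_p ?perm_type_pos ?sumn_perm_type //.
  by rewrite mulrCA mulVf ?mulr1.
move=> u _.
have [/perm_type_conj[v ->]|pe] := boolP (perm_eq (Defs.perm_type u) (Defs.perm_type w)).
  by rewrite chiC.
by rewrite hall_p_orth ?perm_type_pos // !mulr0.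
Qed.

Lemma linear_ext_a_elt n (chi : 'S_n -> K) (g : partial_perm n) :
  linear_ext chi (a_elt K g) = \sum_(w : 'S_n | extends w (pp_map g)) chi w.
Proof.
rewrite /linear_ext [RHS]big_mkcond; apply: eq_bigr => w _.
rewrite /a_elt sum_ffunE.
transitivity ((extends w (pp_map g))%:R * chi w); last first.
  by case: ifP; rewrite ?mul1r ?mul0r.
congr (_ * _); rewrite big_mkcond (bigD1 w) //= big1 ?addr0 => [|u uw].
  by rewrite /perm_elt ffunE eqxx /extends; case: ifP.
by case: ifP => // _; rewrite /perm_elt ffunE eq_sym (negbTE uw).
Qed.

(** [sum_extends] and [in_vars_omega_aug] produce the same [wsum], for the path sizes [mu0] before
    sorting. *)
Lemma sum_extends_forgotten n (g : partial_perm n) :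
  \sum_(w : 'S_n | extends w (pp_map g)) sym_p K (Defs.perm_type w)
  = ((-1) ^+ (sumn (path_type g) - size (path_type g)) * (mult_fact (path_type g))%:R)
    *: (forgotten omega (path_type g) * sym_p K (cycle_type g)).
Proof.
set mu0 := [seq #|C| | C : {set 'I_n} <- enum (components g) & is_dipath g C].
have pm : perm_eq (path_type g) mu0 by rewrite /path_type perm_sort.
have mu00 : 0%N \notin mu0.
  have [_ _ P0] := and3P (components_partition g).
  apply/mapP => -[C]; rewrite mem_filter mem_enum => /andP[_ CP] /esym/eqP.
  by rewrite cards_eq0 => /eqP C0; rewrite -C0 CP in P0.
have E : sym_p K (cycle_type g) * ((-1) ^+ (sumn mu0 - size mu0) *: omega (aug K mu0))
   = \sum_(w : 'S_n | extends w (pp_map g)) sym_p K (Defs.perm_type w).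
  apply: symfunP => N; rewrite in_vars_sum sum_extends in_varsM.
  by rewrite (in_vars_omega_aug omegaP).
rewrite -E mulrC -(perm_size pm) -(perm_aug _ pm).
have -> : sumn mu0 = sumn (path_type g) by rewrite !sumnE (perm_big _ pm).
rewrite -scalerAl -scalerA; congr (_ *: _).
rewrite /aug (sorted_sort geq_trans) ?(sort_sorted geq_total) //.
by rewrite rmorphMn /= -scaler_nat -scalerAl.
Qed.
End Characters.

(* Imported only here because [complex] makes [[i]] a keyword, which breaks intro patterns. *)
From mathcomp Require Import reals complex.

Theorem theorem1p1 (R : realType) (n : nat) (g : partial_perm n)
    (mu nu : seq nat) (mu_path : path_type g = mu) (nu_cycle : cycle_type g = nu)
    (chi : 'S_n -> R[i]) (chi_class : class_function chi)
    (hall : {biscalar symfun R[i]}) (hallP : is_hall hall)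
    (omega : {lrmorphism symfun R[i] -> symfun R[i]}) (omegaP : is_omega omega) :
  linear_ext chi (a_elt R[i] g)
  = (-1) ^+ (sumn mu - size mu) * (mult_fact mu)%:R
    * hall (frob_ch chi) (forgotten omega mu * sym_p R[i] nu).
Proof.
rewrite linear_ext_a_elt -mu_path -nu_cycle.
under eq_bigr => w _ do rewrite -(hall_frob_p hallP omegaP w chi_class).
by rewrite -linear_sumr (sum_extends_forgotten omegaP) linearZr_LR.
Qed.
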